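(* Let $c_\star$ be the sharp comparison constant and $c_0$ the explicit constant (with associated parameter $z$) defined in the context. Then $c_\star = c_0$. In particular: (1) For every integrable real random variable $X$ with $\mathbb{E}[X]=0$ and $\mathbb{P}(|X|>t)\le \min\{1,2e^{-t^2/2}\}$ for all $t\ge 0$, and every convex $f:\mathbb{R}\to\mathbb{R}$, $$\mathbb{E}[f(X)]\le \mathbb{E}[f(c_0G)]$$ whenever the right-hand side is finite. (2) For every $c$ with $0<c<c_0$, there exist an integrable real random variable $X^\star$ with $\mathbb{E}[X^\star]=0$ and $\mathbb{P}(|X^\star|>t)\le \min\{1,2e^{-t^2/2}\}$ for all $t\ge 0$, and a convex function $f:\mathbb{R}\to\mathbb{R}$, such that $\mathbb{E}[f(X^\star)]>\mathbb{E}[f(cG)]$. One may take $f(x)=(x-cz)_+$. Consequently, $C_{48}^{(1)}:=c_\star^2$ equals $c_0^2$.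
   Context: $G\sim\mathcal{N}(0,1)$; $\varphi(x)=(2\pi)^{-1/2}e^{-x^2/2}$ is the standard normal density and $\overline{\Phi}(x)=\int_x^\infty\varphi(t)\,\mathrm{d}t$ the Gaussian tail. $(x)_+=\max\{x,0\}$. Convex domination: for integrable real random variables, $X\preceq_{cx}Y$ means $\mathbb{E}[f(X)]\le\mathbb{E}[f(Y)]$ for every convex $f:\mathbb{R}\to\mathbb{R}$ for which both expectations are finite. The constant $c_\star$ is $$c_\star:=\inf\{c>0:\ X\preceq_{cx}cG\ \text{for every integrable real } X \text{ with } \mathbb{E}[X]=0 \text{ and } \mathbb{P}(|X|>t)\le\min\{1,2e^{-t^2/2}\}\ \forall t\ge0\}.$$ The constant $c_0$ is defined as follows. Let $t_0=\sqrt{2\log 2}$, $A=\int_0^\infty \min\{1,2e^{-t^2/2}\}\,\mathrm{d}t=t_0+2\int_{t_0}^\infty e^{-t^2/2}\,\mathrm{d}t$, and $B=A/2$. For $x\ge t_0$ let $H(x)=2xe^{-x^2/2}+2\int_x^\infty e^{-t^2/2}\,\mathrm{d}t$; $H$ is strictly decreasing with $H(t_0)=A$ and $H(x)\to0$ as $x\to\infty$, so there is a unique $a>t_0$ with $H(a)=B$. Put $p_0=2e^{-a^2/2}\in(0,1)$, let $z$ be the unique real solution of $\overline{\Phi}(z)=p_0$, and set $c_0=B/\varphi(z)$. *)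

(* Defs.v *)
(* Library: MathComp-Analysis. *)
From HB Require Import structures.
From mathcomp Require Import all_boot all_order all_algebra.
From mathcomp Require Import all_classical all_reals all_analysis.

Set Implicit Arguments.
Unset Strict Implicit.
Unset Printing Implicit Defensive.

Import Order.TTheory GRing.Theory Num.Theory.
Import numFieldNormedType.Exports.

Local Open Scope classical_set_scope.
Local Open Scope ring_scope.

Definition convex_on_line (R : realType) (f : R -> R) : Prop :=
  convex_function (E := R^o) setT f.

(* The integral of a measurable function that is not integrable is infinite,
   so the [fin_num] conditions say that both expectations exist and are
   finite. *)
Definition cx_le (R : realType)
    (d1 : measure_display) (T1 : measurableType d1) (P1 : probability T1 R)
    (X : T1 -> R)
    (d2 : measure_display) (T2 : measurableType d2) (P2 : probability T2 R)
    (Y : T2 -> R) : Prop :=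
  forall f : R -> R, convex_on_line f ->
    'E_P1[f \o X]%E \is a fin_num -> 'E_P2[f \o Y]%E \is a fin_num ->
    ('E_P1[f \o X] <= 'E_P2[f \o Y])%E.

Definition tail_bound (R : realType) (t : R) : R :=
  Num.min 1 (2 * expR (- t ^+ 2 / 2)).

Definition centered_tail_bounded (R : realType)
    (d : measure_display) (T : measurableType d) (P : probability T R)
    (X : {RV P >-> R}) : Prop :=
  [/\ P.-integrable setT (EFin \o X),
      'E_P[X]%E = 0%E
    & forall t : R, 0 <= t ->
        (P [set w | (t < `|X w|)%R] <= (tail_bound t)%:E)%E].

(* The Gaussian G is realized as the identity on the probability space
   (R, N(0, 1)); [scaledG c] is then the random variable c G. *)
Definition gaussian (R : realType) : probability (measurableTypeR R) R :=
  @normal_prob R 0 1.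

Definition scaledG (R : realType) (c : R) : measurableTypeR R -> R :=
  fun g => c * g.

Definition c_star (R : realType) : R :=
  inf [set c : R | 0 < c /\
    forall (d : measure_display) (T : measurableType d) (P : probability T R)
      (X : {RV P >-> R}),
      centered_tail_bounded X -> cx_le P X (gaussian R) (scaledG c)].

Definition C48 (R : realType) : R := c_star R ^+ 2.

Definition gauss_density (R : realType) (x : R) : R := normal_pdf 0 1 x.

Definition gauss_tail (R : realType) (x : R) : R :=
  \int[lebesgue_measure]_(t in `[x, +oo[) gauss_density t.

Definition t0 (R : realType) : R := Num.sqrt (2 * ln 2).

Definition constA (R : realType) : R :=
  \int[lebesgue_measure]_(t in `[0, +oo[) tail_bound (t : R).

Definition constB (R : realType) : R := constA R / 2.

Definition Hfun (R : realType) (x : R) : R :=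
  2 * x * expR (- x ^+ 2 / 2)
  + 2 * \int[lebesgue_measure]_(t in `[x, +oo[) expR (- t ^+ 2 / 2).

(* [xget 0 S] is an element of S whenever S is nonempty; the sets below are
   singletons, so the default value 0 plays no role in [a_param] and
   [z_param]. *)
Definition a_param (R : realType) : R :=
  xget 0 [set a : R | t0 R < a /\ Hfun a = constB R].

Definition p0 (R : realType) : R := 2 * expR (- a_param R ^+ 2 / 2).

Definition z_param (R : realType) : R :=
  xget 0 [set z : R | gauss_tail z = p0 R].

Definition c0 (R : realType) : R := constB R / gauss_density (z_param R).

(* Main.v *)
(** The stop-loss transforms [E (X - u)_+] determine the convex order, so it
    suffices to bound them for [u >= 0], for both [X] and [- X].  For admissible
    [X], [E X_+ <= B] because [X_+] and [X_-] share the mean of [|X|], and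
    [E (X - u)_+] is at most the tail integral [int_u^oo tail_bound].  Convexity
    in [u] between [0] and [a] then gives [E (X - u)_+ <= B - u p0] on [0, a],
    and the right-hand side is exactly the tangent line at [u = c0 z] of the
    convex function [u |-> E (c0 G - u)_+].  Beyond [a], the two tails
    [2 e^(-u^2/2)] and [P (c0 G > u)] cross only once, so the comparison at [a]
    and at infinity propagates to all of [[a, +oo[].  The variable with tail
    [tail_bound] that is positive exactly on its largest values (those above
    [a]) attains [B - u p0] and shows that [c0] is optimal. *)
Require Import Defs.
From HB Require Import structures.
From mathcomp Require Import all_boot all_order all_algebra.
From mathcomp Require Import all_classical all_reals all_analysis.
From mathcomp Require Import measurable_realfun ring lra.
Import Order.TTheory GRing.Theory Num.Theory.
Import numFieldNormedType.Exports.
Local Open Scope classical_set_scope.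
Local Open Scope ring_scope.

Set Implicit Arguments.
Unset Strict Implicit.
Unset Printing Implicit Defensive.

(** The integral of [tail_bound] over [[u, +oo[] is too generous near [u = 0]: there it equals
    [constA], twice what mean zero allows. A line starting from [constB] therefore replaces it on
    [[0, a]], and the equation [Hfun a = constB] is what fixes this line. Geometrically, the tangent
    at [a] to the convex function sending [u] to that integral has slope [- p0] and takes the value
    [Hfun a] at [u = 0], so [a] is the point whose tangent starts from [constB]. The Gaussian
    stop-loss transform at scale [c] has slope [- Q z] at [c z], and its tangent there starts from
    [c * phi z]. Matching the two lines gives [Q z = p0] and [c0 = constB / phi z]: [c0] is the
    scale for which one line supports both curves. Probabilistically, when [tail_bound] is the exact
    tail, [Hfun a] is the share of the mean of [|X|] carried by [|X| > a]. Giving a positive sign to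
    exactly those values thus leaves mean zero, so the equation that shapes the upper bound also
    centers the extremal variable. *)

Definition hinge (R : realType) (u x : R) : R := Num.max (x - u) 0.

Lemma hinge_ge0 (R : realType) (u x : R) : 0 <= hinge u x.
Proof. by rewrite le_max lexx orbT. Qed.

Lemma hinge_ge (R : realType) (u x : R) : x - u <= hinge u x.
Proof. by rewrite le_max lexx. Qed.

Lemma hinge_eq0 (R : realType) (u x : R) : x <= u -> hinge u x = 0.
Proof. by move=> xu; rewrite /hinge max_r// subr_le0. Qed.

Lemma hingeE (R : realType) (u x : R) : u <= x -> hinge u x = x - u.
Proof. by move=> xu; rewrite /hinge max_l// subr_ge0. Qed.

Lemma hinge0_norm (R : realType) (x : R) : `|x| = hinge 0 x + hinge 0 (- x).
Proof.
rewrite /hinge !subr0; have [x0|x0] := leP x 0.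
  by rewrite ler0_norm// max_l ?add0r// oppr_ge0.
by rewrite gtr0_norm// max_r ?addr0// oppr_le0 ltW.
Qed.

Lemma measurable_hinge (R : realType) (u : R) : measurable_fun setT (hinge u).
Proof.
by apply: measurable_maxr => //; apply: measurable_funB.
Qed.

(** * Stop-loss transforms and convex domination *)

Section hinge_integral.
Local Open Scope ereal_scope.
Context d (T : measurableType d) (R : realType) (P : probability T R).
Implicit Types (X : T -> R) (u : R).

Lemma measurable_EFin_hinge X u : measurable_fun setT X ->
  measurable_fun setT (fun w => (hinge u (X w))%:E).
Proof.
move=> mX; apply/measurable_EFinP; apply: measurableT_comp mX.
exact: measurable_hinge.
Qed.

Lemma integral_hinge0 X :
  \int[P]_w (X w)%:E =
  \int[P]_w (hinge 0 (X w))%:E - \int[P]_w (hinge 0 (- X w))%:E.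
Proof.
rewrite integralE; congr (_ - _); apply: eq_integral => w _.
  by rewrite funeposE -EFin_max /hinge subr0.
by rewrite funenegE -EFinN -EFin_max /hinge subr0.
Qed.

Lemma integral_norm_hinge0 X : measurable_fun setT X ->
  \int[P]_w `|X w|%:E =
  \int[P]_w (hinge 0 (X w))%:E + \int[P]_w (hinge 0 (- X w))%:E.
Proof.
move=> mX; have mNX : measurable_fun setT (fun w => - X w)%R.
  exact: measurableT_comp.
rewrite -ge0_integralD//.
- by apply: eq_integral => w _; rewrite -EFinD -hinge0_norm.
- by move=> w _; rewrite lee_fin hinge_ge0.
- exact: measurable_EFin_hinge.
- by move=> w _; rewrite lee_fin hinge_ge0.
- exact: measurable_EFin_hinge.
Qed.

Lemma integrable_hinge X u : P.-integrable setT (EFin \o X) ->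
  P.-integrable setT (fun w => (hinge u (X w))%:E).
Proof.
move=> iX; have mX : measurable_fun setT X.
  by apply/measurable_EFinP; exact: measurable_int iX.
apply: (@le_integrable _ _ _ P setT _ _
    (fun w => `|(X w)%:E| + `|u|%:E)) => //.
- exact: measurable_EFin_hinge.
- move=> w _; rewrite -EFinD !abse_EFin lee_fin ger0_norm ?hinge_ge0//.
  rewrite [leRHS]ger0_norm ?addr_ge0// ge_max addr_ge0// andbT.
  by apply: le_trans (ler_norm _) _; exact: ler_normB.
- apply: integrableD => //; first exact: integrable_abse.
  exact: finite_measure_integrable_cst.
Qed.

End hinge_integral.

Section stop_loss_transform.
Local Open Scope ereal_scope.
Context d (T : measurableType d) (R : realType) (P : probability T R).

Let mu : {measure set _ -> \bar R} := @lebesgue_measure R.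

(** Tonelli: [hinge u (X w)] is the length of [[u, X w[]. The interval is open at [X w] so that its
    section at [t] is the strict event [t < X w] of the tail hypothesis. *)
Lemma stop_loss_tail (X : T -> R) (u : R) : measurable_fun setT X ->
  \int[P]_w (hinge u (X w))%:E =
  \int[mu]_(t in `[u, +oo[) P [set w | (t < X w)%R].
Proof.
move=> mX; pose D : set R := `[u, +oo[%classic.
transitivity (\int[P]_w (\int[mu]_t (\1_`[u, X w[ t)%:E)).
  apply: eq_integral => w _.
  rewrite integral_indic//= setIT lebesgue_measure_itv/= lte_fin.
  have [uX|Xu] := ltP u (X w); first by rewrite hingeE ?ltW// EFinN.
  by rewrite hinge_eq0.
transitivity (\int[mu]_t (\int[P]_w (\1_`[u, X w[ t)%:E)).
  rewrite (fubini_tonelli (fun p : T * measurableTypeR R => (\1_`[u, X p.1[ p.2)%:E))//=.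
  apply/measurable_EFinP/measurable_indic => /=.
  pose fsnd (p : T * measurableTypeR R) := (u <= p.2)%R.
  pose f21 (p : T * measurableTypeR R) := (p.2 < X p.1)%R.
  rewrite [X in measurable X](_ : _ =
      fsnd @^-1` [set true] `&` f21 @^-1` [set true]); last first.
    by apply/seteqP; split => p; rewrite in_itv/= => /andP.
  apply: measurableI.
  - have : measurable_fun setT fsnd by exact: measurable_fun_ler.
    by move=> /(_ measurableT [set true]); rewrite setTI; exact.
  - have : measurable_fun setT f21.
      apply: measurable_fun_ltr => //.
      by apply: measurableT_comp => //; exact: measurable_fst.
    by move=> /(_ measurableT [set true]); rewrite setTI; exact.
rewrite [in RHS]integral_mkcond/=.
apply: eq_integral => t _; rewrite patchE.
have [ut|tu] := leP u t; last first.
  rewrite memNset//= ?in_itv/= ?leNgt ?tu//.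
  by apply: integral0_eq => w _; rewrite indicE/= memNset//= in_itv/= leNgt tu.
rewrite mem_set//= ?in_itv/= ?ut//.
have mA : measurable [set w | (t < X w)%R].
  rewrite (_ : [set w | _] = X @^-1` `]t, +oo[) //.
    by rewrite -[X in measurable X]setTI; exact: mX.
  by apply/seteqP; split => w /=; rewrite in_itv/= andbT.
rewrite -[X in _ = P X]setIT -integral_indic//=.
apply: eq_integral => w _; congr EFin; rewrite !indicE; congr (nat_of_bool _)%:R.
by apply/idP/idP; rewrite !inE/= in_itv/= ut.
Qed.

End stop_loss_transform.

(** * Convex functions as limits of nonnegative sums of hinges *)

Section hinge_approximation.
Variables (R : realType) (f : R -> R).

(** Convexity with denominators cleared and degenerate triples allowed: for fixed points it is
    linear in the values of [f], which suits [lra] and [nra]. *)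
Definition chord_convex := forall x y z : R, x <= y -> y <= z ->
  f y * (z - x) <= f x * (z - y) + f z * (y - x).

Definition hinge_coef (h : R) (i : nat) : R :=
  (f (i.+1%:R * h) - 2 * f (i%:R * h) + f ((i%:R - 1) * h)) / h.

(** The knots are shifted by one: [hinge_coef h i] is the slope jump at [i * h] of the piecewise
    linear interpolant of [f], but its hinge sits at [(i + 1) * h]. The sum thus interpolates
    [f (x - h)]. The unshifted interpolant of a convex function lies above it; the shifted one lies
    below as soon as [f] is nondecreasing. *)
Definition hinge_sum (h : R) (n : nat) (x : R) : R :=
  \sum_(i < n) hinge_coef h i * hinge (i.+1%:R * h) x.

Hypothesis cf : chord_convex.

Lemma hinge_coef_ge0 (h : R) i : 0 < h -> 0 <= hinge_coef h i.
Proof.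
move=> h0; rewrite divr_ge0 ?(ltW h0)//.
have := @cf ((i%:R - 1) * h) (i%:R * h) (i.+1%:R * h).
rewrite -natr1 => /(_ ltac:(nra) ltac:(nra)).
set a := f _; set b := f _; set c := f _ => H.
have {H} : h * (2 * a) <= h * (b + c) by lra.
by rewrite ler_pM2l//; lra.
Qed.

Hypothesis f0 : forall x, x <= 0 -> f x = 0.
Hypothesis f_ge0 : forall x, 0 <= f x.

Lemma chord_convex_homo : {homo f : x y / x <= y}.
Proof.
move=> x y xy; have [x0|x0] := leP x 0; first by rewrite f0.
have := @cf 0 x y (ltW x0) xy; rewrite (f0 (lexx 0)) mul0r add0r !subr0.
have y0 : 0 < y by exact: lt_le_trans xy.
move=> H; rewrite -(ler_pM2r y0); apply: le_trans H _.
by rewrite ler_wpM2l.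
Qed.

(** Past the last knot all hinges are active, so the sum is affine and the second differences
    telescope to one first difference. *)
Lemma hinge_sum_active (h : R) n x : 0 < h -> n%:R * h <= x ->
  hinge_sum h n x = f ((n%:R - 1) * h)
    + (f (n%:R * h) - f ((n%:R - 1) * h)) / h * (x - n%:R * h).
Proof.
move=> h0; rewrite /hinge_sum; elim: n x => [|n IH] x nx.
  rewrite big_ord0 mul0r (f0 (lexx _)) f0; last by nra.
  by rewrite subrr mul0r mul0r addr0.
rewrite big_ord_recr/= IH; last by move: nx; rewrite -natr1; nra.
rewrite hingeE// /hinge_coef.
have -> : n.+1%:R - 1 = n%:R :> R by rewrite -natr1; lra.
rewrite -natr1; set a := f _; set b := f _; set c := f _.
by field; rewrite gt_eqF.
Qed.

Lemma hinge_sum_inactive (h : R) k n x : 0 < h -> (k <= n)%N -> x <= k.+1%:R * h ->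
  hinge_sum h n x = hinge_sum h k x.
Proof.
move=> h0 kn xk; rewrite /hinge_sum.
rewrite -!(big_mkord xpredT (fun i => hinge_coef h i * hinge (i.+1%:R * h) x)).
rewrite (big_cat_nat (n := k))//= [X in _ + X]big_nat_cond [X in _ + X]big1 ?addr0// => i.
rewrite andbT => /andP[ki _]; rewrite hinge_eq0 ?mulr0//.
by apply: le_trans xk _; rewrite ler_pM2r// ler_nat.
Qed.

Lemma hinge_sum_le_n (h : R) k n x : 0 < h -> (k <= n)%N ->
  hinge_sum h k x <= hinge_sum h n x.
Proof.
move=> h0 kn; rewrite /hinge_sum.
rewrite -!(big_mkord xpredT (fun i => hinge_coef h i * hinge (i.+1%:R * h) x)).
rewrite (big_cat_nat (n := k) (p := n))//= lerDl big_nat_cond.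
by apply: sumr_ge0 => i _; rewrite mulr_ge0 ?hinge_ge0 ?hinge_coef_ge0.
Qed.

Lemma hinge_sum_ge0 (h : R) n x : 0 < h -> 0 <= hinge_sum h n x.
Proof.
by move=> h0; apply: sumr_ge0 => i _; rewrite mulr_ge0 ?hinge_ge0 ?hinge_coef_ge0.
Qed.

(** On the grid cell [k * h <= x < (k + 1) * h] the sum of [k] hinges is a convex combination of
    [f ((k - 1) * h)] and [f (k * h)], and monotonicity of [f] gives both bounds. Hinges of index
    [k] or more vanish at [x]; dropping some of smaller index only lowers the sum, so only the lower
    bound asks that the grid reach [x]. *)
Lemma hinge_sum_bounds (h : R) n x : 0 < h ->
  hinge_sum h n x <= f x /\ (x <= n%:R * h -> f (x - 2 * h) <= hinge_sum h n x).
Proof.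
move=> h0; have [x0|x0] := leP x 0.
  have S0 : hinge_sum h n x = 0.
    by rewrite (@hinge_sum_inactive h 0 n)// ?/hinge_sum ?big_ord0//; nra.
  by rewrite S0 !f0//; lra.
pose k := Num.truncn (x / h).
have xh0 : 0 <= x / h by rewrite divr_ge0// ltW.
have /andP[] := truncn_itv xh0; rewrite -/k => kx xk.
have {}kx : k%:R * h <= x by rewrite -ler_pdivlMr.
have {}xk : x < k.+1%:R * h by rewrite -ltr_pdivrMr.
have Sk := @hinge_sum_active h k x h0 kx.
have H1 : f ((k%:R - 1) * h) <= f (k%:R * h) by apply: chord_convex_homo; nra.
have H2 : f (k%:R * h) <= f x by apply: chord_convex_homo.
have H3 : f (x - 2 * h) <= f ((k%:R - 1) * h).
  by apply: chord_convex_homo; move: xk; rewrite -natr1; nra.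
have [t [t0 t1 tE]] : exists t, [/\ 0 <= t, t <= 1 &
    (f (k%:R * h) - f ((k%:R - 1) * h)) / h * (x - k%:R * h)
    = (f (k%:R * h) - f ((k%:R - 1) * h)) * t].
  exists ((x - k%:R * h) / h); split.
  - by rewrite divr_ge0 ?subr_ge0// ltW.
  - by rewrite ler_pdivrMr//; move: xk; rewrite -natr1; nra.
  - by rewrite mulrAC mulrA.
rewrite tE in Sk.
have Skx : hinge_sum h k x <= f x by rewrite Sk; nra.
split.
  have [kn|nk] := leqP k n; last by apply: le_trans Skx; exact: hinge_sum_le_n (ltnW nk).
  by rewrite (@hinge_sum_inactive h k n)// ltW.
move=> xn; rewrite (@hinge_sum_inactive h k n)//; last by rewrite ltW.
  rewrite Sk; apply: le_trans H3 _; nra.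
have : k%:R * h <= n%:R * h by exact: le_trans xn.
by rewrite ler_pM2r// ler_nat.
Qed.

(** With mesh [1 / (n + 1)], taking [(n + 1)^2] hinges makes the grid reach [n + 1]: the mesh
    shrinks while the range grows. *)
Definition hinge_approx (n : nat) : R -> R := hinge_sum n.+1%:R^-1 (n.+1 * n.+1).

Lemma hinge_approx_le n x : hinge_approx n x <= f x.
Proof. by have [] := @hinge_sum_bounds n.+1%:R^-1 (n.+1 * n.+1) x. Qed.

Lemma hinge_approx_ge0 n x : 0 <= hinge_approx n x.
Proof. exact: hinge_sum_ge0. Qed.

Lemma measurable_hinge_approx n : measurable_fun setT (hinge_approx n).
Proof.
apply: measurable_sum => i; apply: measurable_funM => //.
exact: measurable_hinge.
Qed.

Lemma hinge_approx_cvg x : hinge_approx n x @[n --> \oo] --> f x.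
Proof.
(* The chord inequality at [x - 2 * h], [x], [x + 1] gives [f (x - 2 * h) >= f x - 2 * h * (f (x +
   1) - f x)], an explicit rate standing in for continuity of [f]. *)
apply: (@squeeze_cvgr _ _ _ _
  (fun n => f x - 2 * (f (x + 1) - f x) * n.+1%:R^-1) (cst (f x))); last 2 first.
- rewrite -[X in _ --> X]subr0 -(mulr0 (2 * (f (x + 1) - f x))).
  apply: cvgB; first exact: cvg_cst.
  by apply: cvgMr; exact: cvg_harmonic.
- exact: cvg_cst.
near=> n; rewrite hinge_approx_le andbT.
have [_ H] := @hinge_sum_bounds n.+1%:R^-1 (n.+1 * n.+1) x (ltac:(by rewrite invr_gt0)).
apply: le_trans (H _); last first.
  rewrite natrM mulfK ?pnatr_eq0//.
  by apply: (@le_trans _ _ n%:R); [near: n; exact: nbhs_infty_ger|rewrite ler_nat].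
have := @cf (x - 2 * n.+1%:R^-1) x (x + 1).
have : 0 < n.+1%:R^-1 :> R by rewrite invr_gt0.
set h := _^-1 => h0 /(_ ltac:(lra) ltac:(lra)).
by set a := f _; set b := f _; set c := f _ => K; lra.
Unshelve. all: by end_near. Qed.

End hinge_approximation.
Lemma limn_einf_le (R : realType) (u : nat -> \bar R) (M : \bar R) :
  (forall n, (u n <= M)%E) -> (limn_einf u <= M)%E.
Proof.
move=> uM; rewrite limn_einf_lim; apply: lime_le; first exact: is_cvg_einfs.
near=> n; apply: le_trans (uM n); apply: ge_ereal_inf.
by exists (u n) => //; exists n => /=.
Unshelve. all: by end_near. Qed.

(** * From hinges to arbitrary convex functions *)

Section hinge_domination.
Context d1 (T1 : measurableType d1) d2 (T2 : measurableType d2) (R : realType).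
Variables (P1 : probability T1 R) (P2 : probability T2 R).

Lemma measurable_chord_convex (f : R -> R) : chord_convex f ->
  (forall x, x <= 0 -> f x = 0) -> (forall x, 0 <= f x) -> measurable_fun setT f.
Proof.
move=> cf f0 f_ge0; apply: (@measurable_fun_cvg _ _ _ _ (hinge_approx f)).
  exact: measurable_hinge_approx.
by move=> x _; exact: hinge_approx_cvg.
Qed.

Lemma integral_hinge_approx d (T : measurableType d) (P : probability T R)
    (f : R -> R) (X : T -> R) n : chord_convex f ->
  measurable_fun setT X ->
  (\int[P]_w (hinge_approx f n (X w))%:E =
   \sum_(i < n.+1 * n.+1) (hinge_coef f n.+1%:R^-1 i)%:E *
      \int[P]_w (hinge (i.+1%:R * n.+1%:R^-1) (X w))%:E)%E.
Proof.
move=> cf mX; rewrite /hinge_approx /hinge_sum.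
have c0 i : (0 <= hinge_coef f n.+1%:R^-1 i) by exact: hinge_coef_ge0.
have mh u := measurable_EFin_hinge u mX.
under eq_integral do rewrite -sumEFin.
rewrite ge0_integral_sum//; last 2 first.
- by move=> i; under eq_fun do rewrite EFinM; exact: measurable_funeM.
- by move=> i w _; rewrite lee_fin mulr_ge0 ?hinge_ge0.
apply: eq_bigr => i _; under eq_integral do rewrite EFinM.
by rewrite ge0_integralZl_EFin// => w _; rewrite lee_fin hinge_ge0.
Qed.

(** The meshes are not nested, so Fatou takes the place of monotone convergence: pointwise
    convergence is used on the side of [X], and on the side of [Y] only that the approximations stay
    below [f]. Infinite expectations are allowed. *)
Lemma hinge_domination_nonneg (f : R -> R) (X : T1 -> R) (Y : T2 -> R) :
  chord_convex f -> (forall x, x <= 0 -> f x = 0) -> (forall x, 0 <= f x) ->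
  measurable_fun setT X -> measurable_fun setT Y ->
  (forall u, (0 <= u)%R ->
    \int[P1]_w (hinge u (X w))%:E <= \int[P2]_w (hinge u (Y w))%:E)%E ->
  (\int[P1]_w (f (X w))%:E <= \int[P2]_w (f (Y w))%:E)%E.
Proof.
move=> cf f0 f_ge0 mX mY XY.
have mf := measurable_chord_convex cf f0 f_ge0.
pose S n w := (hinge_approx f n (X w))%:E.
have -> : (\int[P1]_w (f (X w))%:E = \int[P1]_w limn_einf (S^~ w))%E.
  apply: eq_integral => w _; apply/esym.
  have /cvg_limn_einf_sup[-> _]// : S n w @[n --> \oo] --> (f (X w))%:E.
  by apply: cvg_EFin; [exact: nearW|exact: hinge_approx_cvg].
apply: le_trans (fatou _ _ _ _) _ => //.
- move=> n; apply/measurable_EFinP; apply: measurableT_comp => //.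
  exact: measurable_hinge_approx.
- by move=> n w _; rewrite lee_fin hinge_approx_ge0.
apply: limn_einf_le => n; rewrite /S integral_hinge_approx//.
apply: (@le_trans _ _ (\int[P2]_w (hinge_approx f n (Y w))%:E)%E).
  rewrite integral_hinge_approx//; apply: lee_sum => i _.
  apply: lee_wpmul2l; first by rewrite lee_fin hinge_coef_ge0.
  by apply: XY; rewrite mulr_ge0.
apply: ge0_le_integral => //.
- by move=> w _; rewrite lee_fin hinge_approx_ge0.
- apply/measurable_EFinP; apply: measurableT_comp => //.
  exact: measurable_hinge_approx.
- by apply/measurable_EFinP; exact: measurableT_comp.
- by move=> w _; rewrite lee_fin hinge_approx_le.
Qed.

Lemma convex_on_line_chord_convex (f : R -> R) : convex_on_line f -> chord_convex f.
Proof.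
move=> cf x y z xy yz.
have [zx|xz] := leP z x.
  have -> : y = x by lra.
  have -> : z = x by lra.
  by rewrite subrr !mulr0 addr0.
have z0 : 0 < z - x by rewrite subr_gt0.
have t01 : 0 <= (z - y) / (z - x) <= 1.
  by rewrite divr_ge0 ?subr_ge0 ?(ltW xz)//= ler_pdivrMr// mul1r; lra.
have := cf (@Itv01 R ((z - y) / (z - x)) (andP t01).1 (andP t01).2) x z.
rewrite !inE => /(_ I I).
rewrite -[X in f X]/(_ * x + (1 - _) * z) -[leRHS]/(_ * f x + (1 - _) * f z)/=.
have -> : (z - y) / (z - x) * x + (1 - (z - y) / (z - x)) * z = y.
  by field; rewrite gt_eqF.
move=> H.
have -> : f x * (z - y) + f z * (y - x) =
    ((z - y) / (z - x) * f x + (1 - (z - y) / (z - x)) * f z) * (z - x).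
  by field; rewrite gt_eqF.
by rewrite ler_pM2r.
Qed.

Lemma chord_convex_convex_on_line (f : R -> R) : chord_convex f -> convex_on_line f.
Proof.
move=> cf t x y _ _.
rewrite -[X in f X]/(_ * x + (1 - _) * y) -[leRHS]/(_ * f x + (1 - _) * f y)/=.
have t0 : 0 <= t%:num by []. have t1 : t%:num <= 1 by [].
move: t0 t1; set s := t%:num => t0 t1.
have [->|] := eqVneq x y.
  by rewrite -!mulrDl subrKC !mul1r.
wlog xy : x y s t0 t1 / x < y => [H|_].
  move=> xy; move: (xy); rewrite neq_lt => /orP[/H|yx]; first exact.
  have := H y x (1 - s) ltac:(lra) ltac:(lra) yx.
  rewrite subKr ![_ + s * _]addrC; apply; rewrite eq_sym//.
have := cf x (s * x + (1 - s) * y) y ltac:(nra) ltac:(nra).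
set a := f _; set b := f x; set c := f y.
have -> : y - (s * x + (1 - s) * y) = s * (y - x) by ring.
have -> : s * x + (1 - s) * y - x = (1 - s) * (y - x) by ring.
by rewrite !mulrA -mulrDl ler_pM2r ?subr_gt0// ![_ * s]mulrC ![_ * (1 - s)]mulrC.
Qed.

(** The slope is the infimum of the difference quotients to the right of 0; convexity across 0 makes
    every quotient to the left a lower bound of them. *)
Lemma support_line (f : R -> R) : chord_convex f ->
  exists s, forall x, f 0 + s * x <= f x.
Proof.
move=> cf; pose D := [set (f x - f 0) / x | x in [set x | 0 < x]].
have lb y : y < 0 -> lbound D ((f y - f 0) / y).
  move=> y0 _ [x /= x0 <-].
  have := cf y 0 x (ltW y0) (ltW x0) => H.
  rewrite ler_pdivlMr// mulrAC ler_ndivrMr//; lra.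
have D0 : D !=set0 by exists ((f 1 - f 0) / 1); exists 1 => /=.
have hD : has_inf D by split => //; exists ((f (-1) - f 0) / (-1)); apply: lb; lra.
exists (inf D) => x; have [x0|x0|->] := ltgtP x 0; last by rewrite mulr0 addr0.
- have : (f x - f 0) / x <= inf D by apply: lb_le_inf => //; exact: lb.
  by rewrite ler_ndivrMr//; lra.
- have : inf D <= (f x - f 0) / x by apply: ge_inf; [exact: hD.2|exists x].
  by rewrite ler_pdivlMr//; lra.
Qed.

(** Since [f] has its minimum 0 at 0, it is nondecreasing on the right, and flattening it on the
    left keeps the slopes monotone. *)
Lemma chord_convex_pos_part (f : R -> R) :
  chord_convex f -> f 0 = 0 -> (forall x, 0 <= f x) ->
  chord_convex (fun x => f (Num.max x 0)).
Proof.
move=> cf f0 f_ge0 x y z xy yz.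
have [y0|y0] := leP y 0.
  by rewrite f0 mul0r addr_ge0// mulr_ge0 ?f_ge0//; lra.
rewrite (max_l (ltW (lt_le_trans y0 yz))).
have [x0|x0] := leP x 0; last exact: cf.
rewrite f0 mul0r add0r.
have := cf 0 y z (ltW y0) yz; rewrite f0 mul0r add0r !subr0.
have := f_ge0 z; have := f_ge0 y.
set a := f y; set b := f z => a0 b0 H.
have ab : a <= b.
  rewrite -(ler_pM2r (lt_le_trans y0 yz)); apply: le_trans H _.
  by rewrite ler_wpM2l.
nra.
Qed.

Lemma chord_convex_opp (f : R -> R) : chord_convex f -> chord_convex (fun x => f (- x)).
Proof.
move=> cf x y z xy yz; have := cf (- z) (- y) (- x).
rewrite !lerN2 => /(_ yz xy).
by rewrite !opprK; lra.
Qed.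

(** The negative part of [g] is dominated by that of [l], hence has finite integral; a finite value
    of the difference that defines the integral then bounds the positive part. *)
Lemma integrable_bounded_below d (T : measurableType d) (P : probability T R)
    (g l : T -> R) :
  measurable_fun setT g -> P.-integrable setT (EFin \o l) ->
  (forall w, l w <= g w) -> (\int[P]_w (g w)%:E)%E \is a fin_num ->
  P.-integrable setT (EFin \o g).
Proof.
move=> mg il lg; rewrite integralE => fing.
have mEg : measurable_fun setT (EFin \o g) by exact/measurable_EFinP.
have neg : (\int[P]_w (EFin \o g)^\- w < +oo)%E.
  have := integral_funeneg_lt_pinfty measurableT il; apply: le_lt_trans.
  apply: ge0_le_integral => //.
  - exact: measurable_funeneg.
  - by apply: measurable_funeneg; exact: measurable_int il.
  - move=> w _; rewrite !funenegE/= -!EFin_max lee_fin.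
    rewrite ge_max !le_max lexx orbT andbT; apply/orP; left.
    by rewrite lerN2.
have pos : (\int[P]_w (EFin \o g)^\+ w < +oo)%E.
  by move: fing; rewrite fin_numB => /andP[+ _]; rewrite ltey_eq => ->.
apply/integrableP; split => //.
rewrite (eq_integral (fun w => (EFin \o g)^\+ w + (EFin \o g)^\- w)%E).
  rewrite ge0_integralD//.
  - exact: lte_add_pinfty.
  - exact: measurable_funepos.
  - exact: measurable_funeneg.
by move=> w _; rewrite -[RHS]/(((EFin \o g)^\+ \+ (EFin \o g)^\-)%E w) -fune_abse.
Qed.

(** A support line at 0 is subtracted; equality of the means makes its contribution the same on both
    sides. The nonnegative remainder vanishes at 0 and splits there into two one-sided convex
    functions, one tested on [X] and [Y], the other on [- X] and [- Y]. *)
Lemma hinge_domination_convex (f : R -> R) (X : T1 -> R) (Y : T2 -> R) :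
  chord_convex f ->
  P1.-integrable setT (EFin \o X) -> P2.-integrable setT (EFin \o Y) ->
  (\int[P1]_w (X w)%:E = \int[P2]_w (Y w)%:E)%E ->
  (forall u, (0 <= u)%R ->
    \int[P1]_w (hinge u (X w))%:E <= \int[P2]_w (hinge u (Y w))%:E)%E ->
  (forall u, (0 <= u)%R ->
    \int[P1]_w (hinge u (- X w))%:E <= \int[P2]_w (hinge u (- Y w))%:E)%E ->
  (\int[P2]_w (f (Y w))%:E)%E \is a fin_num ->
  (\int[P1]_w (f (X w))%:E <= \int[P2]_w (f (Y w))%:E)%E.
Proof.
move=> cf iX iY EXY hp hn finY.
have mX : measurable_fun setT X by apply/measurable_EFinP; exact: measurable_int iX.
have mY : measurable_fun setT Y by apply/measurable_EFinP; exact: measurable_int iY.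
have [s fs] := support_line cf.
pose l x := f 0 + s * x.
pose g x := f x - l x.
have cg : chord_convex g.
  by move=> x y z xy yz; rewrite /g /l; have := cf x y z xy yz; lra.
have g0 : g 0 = 0 by rewrite /g /l; lra.
have g_ge0 x : 0 <= g x by rewrite subr_ge0 fs.
pose gp x := g (Num.max x 0).
(* The left branch of [g], reflected so that [gp] and [gn] both vanish on the nonpositive
   half-line. *)
pose gn x := g (- Num.max x 0).
have gpn x : g x = gp x + gn (- x).
  rewrite /gp /gn; have [x0|x0] := leP x 0.
    by rewrite g0 add0r max_l ?opprK// oppr_ge0.
  by rewrite max_r ?oppr_le0 ?oppr0 ?g0 ?addr0// ltW.
have cgp : chord_convex gp by exact: chord_convex_pos_part.
have cgn : chord_convex gn.
  apply: (chord_convex_pos_part (f := fun x => g (- x))) => //.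
    exact: chord_convex_opp.
  by rewrite oppr0.
have gp0 x : x <= 0 -> gp x = 0 by move=> x0; rewrite /gp max_r.
have gn0 x : x <= 0 -> gn x = 0 by move=> x0; rewrite /gn max_r// oppr0.
have gp_ge0 x : 0 <= gp x by exact: g_ge0.
have gn_ge0 x : 0 <= gn x by exact: g_ge0.
have mgp := measurable_chord_convex cgp gp0 gp_ge0.
have mgn := measurable_chord_convex cgn gn0 gn_ge0.
have mg : measurable_fun setT g.
  rewrite (_ : g = gp \+ (gn \o -%R)); last exact/funext.
  by apply: measurable_funD => //; apply: measurableT_comp => //; exact: measurableT_comp.
have ml : measurable_fun setT l.
  by apply: measurable_funD => //; exact: measurable_funM.
have fE x : f x = l x + g x by rewrite /g subrKC.
have mf : measurable_fun setT f.
  by rewrite (_ : f = l \+ g); [exact: measurable_funD|exact/funext].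
have il d (T : measurableType d) (P : probability T R) (Z : T -> R) :
    P.-integrable setT (EFin \o Z) -> P.-integrable setT (fun w => (l (Z w))%:E).
  move=> iZ; under eq_fun do rewrite /l EFinD EFinM.
  apply: integrableD => //; first exact: finite_measure_integrable_cst.
  exact: integrableZl.
have El d (T : measurableType d) (P : probability T R) (Z : T -> R) :
    P.-integrable setT (EFin \o Z) ->
    (\int[P]_w (l (Z w))%:E = (f 0)%:E + s%:E * \int[P]_w (Z w)%:E)%E.
  move=> iZ; under eq_integral do rewrite /l EFinD EFinM.
  rewrite integralD//=; last 2 first.
  - exact: finite_measure_integrable_cst.
  - exact: integrableZl.
  by rewrite integral_cst//= probability_setT mule1 integralZl.
have ifY : P2.-integrable setT (fun w => (f (Y w))%:E).
  apply: (@integrable_bounded_below _ _ _ (f \o Y) (l \o Y)) => //.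
  - exact: measurableT_comp.
  - exact: il.
  - by move=> w; exact: fs.
have igY : P2.-integrable setT (fun w => (g (Y w))%:E).
  by under eq_fun do rewrite /g EFinB; apply: integrableB => //; exact: il.
have Eg d (T : measurableType d) (P : probability T R) (Z : T -> R) :
    measurable_fun setT Z ->
    (\int[P]_w (g (Z w))%:E =
      \int[P]_w (gp (Z w))%:E + \int[P]_w (gn (- Z w))%:E)%E.
  move=> mZ; under eq_integral do rewrite gpn EFinD.
  rewrite ge0_integralD//.
  - by move=> w _; rewrite lee_fin.
  - by apply/measurable_EFinP; exact: measurableT_comp.
  - by move=> w _; rewrite lee_fin.
  - by apply/measurable_EFinP; do 2 apply: measurableT_comp => //.
have XYg : (\int[P1]_w (g (X w))%:E <= \int[P2]_w (g (Y w))%:E)%E.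
  have mNX : measurable_fun setT (fun w => - X w) by exact: measurableT_comp.
  have mNY : measurable_fun setT (fun w => - Y w) by exact: measurableT_comp.
  rewrite (Eg _ _ _ _ mX) (Eg _ _ _ _ mY); apply: leeD.
    exact: (hinge_domination_nonneg cgp gp0 gp_ge0 mX mY hp).
  exact: (hinge_domination_nonneg cgn gn0 gn_ge0 mNX mNY hn).
(* Integrability on the side of [X] comes out of the comparison itself, since [g] is nonnegative. *)
have igX : P1.-integrable setT (fun w => (g (X w))%:E).
  apply/integrableP; split.
    by apply/measurable_EFinP; exact: measurableT_comp.
  under eq_integral do rewrite gee0_abs ?lee_fin//.
  apply: le_lt_trans XYg _; case/integrableP : igY => _.
  by under eq_integral do rewrite gee0_abs ?lee_fin//.
under eq_integral do rewrite fE EFinD.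
under [leRHS]eq_integral do rewrite fE EFinD.
rewrite !integralD//; [|exact: il..].
by rewrite !El// EXY leeD2l.
Qed.

End hinge_domination.
(** * The Gaussian tail *)

Section gaussian_tail.
Variable R : realType.
Local Notation phi := (@gauss_density R).
Local Notation Q := (@gauss_tail R).
Local Notation mu := (@lebesgue_measure R).

Lemma gauss_densityE (x : R) :
  phi x = (Num.sqrt (2 * pi))^-1 * expR (- x ^+ 2 / 2).
Proof.
rewrite /gauss_density normal_pdfE ?oner_neq0// /normal_peak /normal_fun.
by rewrite subr0 expr1n mul1r mulr_natl.
Qed.

Lemma gauss_density_gt0 (x : R) : 0 < phi x.
Proof.
rewrite gauss_densityE mulr_gt0 ?expR_gt0// invr_gt0 sqrtr_gt0.
by rewrite mulr_gt0// pi_gt0.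
Qed.

Lemma gauss_density_ge0 (x : R) : 0 <= phi x.
Proof. exact: ltW (gauss_density_gt0 x). Qed.

Lemma gauss_densityN (x : R) : phi (- x) = phi x.
Proof. by rewrite !gauss_densityE sqrrN. Qed.

Lemma gauss_density_le0 (x : R) : phi x <= (Num.sqrt (2 * pi))^-1.
Proof.
rewrite gauss_densityE ler_piMr ?invr_ge0 ?sqrtr_ge0//.
by rewrite -expR0 ler_expR mulNr oppr_le0 divr_ge0 ?sqr_ge0.
Qed.

Lemma continuous_gauss_density : continuous phi.
Proof. by apply: continuous_normal_pdf; rewrite oner_neq0. Qed.

Lemma measurable_gauss_density : measurable_fun setT phi.
Proof. exact: measurable_normal_pdf. Qed.

Lemma integrable_gauss_density (A : set R) : measurable A ->
  mu.-integrable A (fun x => (phi x)%:E).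
Proof.
move=> mA; apply: (@integrableS _ _ _ _ setT) => //.
exact: integrable_normal_pdf.
Qed.

Lemma is_derive_gauss_exp (x : R) :
  is_derive x 1 (fun x : R => expR (- x ^+ 2 / 2)) (- x * expR (- x ^+ 2 / 2)).
Proof.
have H : is_derive x 1 (fun x : R => - x ^+ 2 / 2) (- x).
  have -> : (fun x : R => - x ^+ 2 / 2) = (fun x => (- 2^-1) * (x * x)).
    by apply/funext => y; field.
  by apply: is_derive_eq; rewrite /GRing.scale/=; field.
have := @is_derive1_comp _ expR (fun x : R => - x ^+ 2 / 2) x _ _ (is_derive_expR _) H.
by rewrite mulrC.
Qed.

Lemma is_derive_gauss_density (x : R) : is_derive x 1 phi (- x * phi x).
Proof.
have -> : phi = (fun x => (Num.sqrt (2 * pi))^-1 * expR (- x ^+ 2 / 2)).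
  by apply/funext => y; exact: gauss_densityE.
have H := is_derive_gauss_exp x.
by apply: is_derive_eq; rewrite /GRing.scale/= mulrCA !mulrA.
Qed.

Lemma integral_density_fin_num (A : set R) : measurable A ->
  (\int[mu]_(x in A) (phi x)%:E)%E \is a fin_num.
Proof.
by move=> mA; apply: integrable_fin_num => //; exact: integrable_gauss_density.
Qed.

Lemma gauss_tailE (x : R) : (Q x)%:E = (\int[mu]_(t in `[x, +oo[) (phi t)%:E)%E.
Proof. by rewrite /gauss_tail /Rintegral fineK// integral_density_fin_num. Qed.

Lemma gaussian_gt (x : R) : gaussian R [set g | x < g] = (Q x)%:E.
Proof.
rewrite gauss_tailE -integral_itv_obnd_cbnd; last first.
  by apply/measurable_EFinP; apply: measurable_funTS; exact: measurable_gauss_density.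
rewrite /gaussian/= /normal_prob; congr (integral _ _ _).
by apply/seteqP; split => y /=; rewrite in_itv/= andbT.
Qed.

Lemma gaussian_le (x : R) : gaussian R [set g | g <= x] = (1 - Q x)%:E.
Proof.
have -> : [set g | g <= x] = ~` [set g | x < g].
  by apply/seteqP; split => y /=; rewrite leNgt => /negP.
rewrite probability_setC ?gaussian_gt//.
have -> : [set g | x < g] = `]x, +oo[%classic :> set R.
  by apply/seteqP; split => y /=; rewrite in_itv/= andbT.
exact: measurable_itv.
Qed.

Lemma gauss_tailN (x : R) : Q (- x) = 1 - Q x.
Proof.
apply: EFin_inj; rewrite -gaussian_le gauss_tailE.
have := @ge0_integration_by_substitutionNy R phi (- x).
rewrite opprK => H; rewrite /gaussian/= /normal_prob.
have -> : [set g | g <= x] = `]-oo, x]%classic :> set R.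
  by apply/seteqP; split => y /=; rewrite in_itv.
rewrite -[RHS]/(\int[mu]_(t in `]-oo, x]) (phi t)%:E)%E H.
- by apply: eq_integral => t _; rewrite /= gauss_densityN.
- by apply: continuous_subspaceT; exact: continuous_gauss_density.
- by move=> y _; exact: gauss_density_ge0.
Qed.

Lemma gauss_tail_ge0 (x : R) : 0 <= Q x.
Proof. by rewrite -lee_fin -gaussian_gt measure_ge0. Qed.

Lemma gauss_tail_le1 (x : R) : Q x <= 1.
Proof. by rewrite -subr_ge0 -gauss_tailN gauss_tail_ge0. Qed.

Lemma is_derive_gauss_tail (x : R) : is_derive x 1 Q (- phi x).
Proof.
pose F (y : R) := \int[mu]_(t in `]-oo, y]) phi t.
have QF : Q = (fun y => 1 - F y).
  apply/funext => y; suff -> : F y = 1 - Q y by rewrite subKr.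
  apply: EFin_inj; rewrite -gaussian_le /F /Rintegral.
  by rewrite fineK ?integral_density_fin_num.
have [dF F'] : derivable F x 1 /\ F^`()%classic x = phi x.
  apply: (@continuous_FTC1 R phi -oo%O x (x + 1)).
  - by rewrite ltrDl.
  - exact: integrable_gauss_density.
  - by rewrite ltNyr.
  - exact: continuous_gauss_density.
have DF : is_derive x 1 F (phi x).
  by rewrite -F' derive1E; exact/derivableP.
by rewrite QF; apply: is_derive_eq; rewrite add0r mul1r.
Qed.

Lemma continuous_gauss_tail : continuous Q.
Proof.
move=> x; apply: differentiable_continuous; apply/derivable1_diffP.
by have [] := is_derive_gauss_tail x.
Qed.

Lemma cvg_gauss_density : phi x @[x --> +oo] --> 0.
Proof.
(* [- x ^+ 2 / 2 <= 1 - x], because [1 - x + x^2 / 2] is half of [(x - 1)^2 + 1]. *)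
apply: (@squeeze_cvgr _ _ _ _ (cst 0) (fun x => expR 1 * expR (- x))).
- near=> x; rewrite gauss_density_ge0/= gauss_densityE -expRD.
  have s1 : 1 <= Num.sqrt (2 * pi) :> R.
    rewrite -[leLHS]sqrtr1 ler_sqrt ?mulr_ge0 ?pi_ge0//.
    by have := pi_ge2 R; lra.
  apply: (@le_trans _ _ (1 * expR (- x ^+ 2 / 2))).
    by rewrite ler_wpM2r ?expR_ge0// invf_le1// (lt_le_trans _ s1).
  by rewrite mul1r ler_expR; nra.
- exact: cvg_cst.
- rewrite -[X in _ --> X](mulr0 (expR 1 : R)).
  by apply: cvgMr; exact: cvgr_expR.
Unshelve. all: by end_near. Qed.

Lemma integral_id_density (x : R) : 0 < x ->
  (\int[mu]_(t in `[x, +oo[) (t * phi t)%:E)%E = (phi x)%:E.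
Proof.
move=> x0; rewrite (@ge0_continuous_FTC2y _ _ (fun t => - phi t) x 0).
- by rewrite sub0e EFinN oppeK.
- by move=> y xy; rewrite mulr_ge0 ?gauss_density_ge0// (le_trans (ltW x0)).
- apply: continuous_subspaceT => y; apply: continuousM; first exact: cvg_id.
  exact: continuous_gauss_density.
- by rewrite -[X in _ --> X]oppr0; apply: cvgN; exact: cvg_gauss_density.
- by move=> y _; have H := is_derive_gauss_density y; apply: derivableN.
- apply: cvgN; apply: cvg_at_right_filter; exact: continuous_gauss_density.
- move=> y _; rewrite derive1E; have H := is_derive_gauss_density y.
  by rewrite deriveN// derive_val mulNr opprK.
Qed.

(** On the domain of integration [x <= t], and [t * phi t] integrates exactly. The bound removes the
    boundary term [t * Q t] in the Gaussian stop-loss integral and provides the decay used to locate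
    [a] and [z]. *)
Lemma gauss_tail_mills (x : R) : 0 < x -> x * Q x <= phi x.
Proof.
move=> x0; rewrite -lee_fin EFinM gauss_tailE -integral_id_density//.
rewrite -ge0_integralZl_EFin//; last 3 first.
- by move=> t _; rewrite lee_fin gauss_density_ge0.
- by apply/measurable_EFinP; apply: measurable_funTS; exact: measurable_gauss_density.
- exact: ltW.
apply: ge0_le_integral => //.
- by move=> t _; rewrite mule_ge0// lee_fin ?gauss_density_ge0// ltW.
- apply: measurable_funeM; apply/measurable_EFinP; apply: measurable_funTS.
  exact: measurable_gauss_density.
- apply/measurable_EFinP; apply: measurable_funTS; apply: measurable_funM => //.
  exact: measurable_gauss_density.
- move=> t /=; rewrite in_itv/= andbT => xt.
  by rewrite -EFinM lee_fin ler_wpM2r// gauss_density_ge0.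
Qed.

Lemma gaussian_hinge (u : R) :
  (\int[gaussian R]_g (hinge u g)%:E)%E = (phi u - u * Q u)%:E.
Proof.
rewrite (@stop_loss_tail _ _ _ (gaussian R) id u)//.
under eq_integral do rewrite gaussian_gt.
rewrite (@ge0_continuous_FTC2y _ Q (fun t => t * Q t - phi t) u 0).
- by rewrite sub0e -EFinN opprB.
- by move=> x _; exact: gauss_tail_ge0.
- by apply: continuous_subspaceT; exact: continuous_gauss_tail.
- rewrite -[X in _ --> X](subrr 0); apply: cvgB; last exact: cvg_gauss_density.
  apply: (@squeeze_cvgr _ _ _ _ (cst 0) phi).
  + near=> x; rewrite gauss_tail_mills ?mulr_ge0 ?gauss_tail_ge0//.
  + exact: cvg_cst.
  + exact: cvg_gauss_density.
- move=> x _; have H1 := is_derive_gauss_density x.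
  by have H2 := is_derive_gauss_tail x; apply: ex_derive.
- apply: cvg_at_right_filter; apply: cvgB; last exact: continuous_gauss_density.
  by apply: cvgM; [exact: cvg_id|exact: continuous_gauss_tail].
- move=> x _; rewrite derive1E.
  have H1 := is_derive_gauss_density x; have H2 := is_derive_gauss_tail x.
  by rewrite derive_val /GRing.scale/=; ring.
Unshelve. all: by end_near. Qed.

End gaussian_tail.

(** * Stop-loss transform, symmetry and mean of the scaled Gaussian *)

Section scaled_gaussian.
Variables (R : realType) (c : R).
Hypothesis c0 : 0 < c.
Local Notation phi := (@gauss_density R).
Local Notation Q := (@gauss_tail R).
Local Notation mu := (@lebesgue_measure R).

Lemma measurable_scaledG : measurable_fun setT (scaledG c).
Proof. exact: measurable_funM. Qed.

Lemma scaledG_hinge (u : R) :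
  (\int[gaussian R]_g (hinge u (scaledG c g))%:E)%E =
  (c * phi (u / c) - u * Q (u / c))%:E.
Proof.
have E g : hinge u (scaledG c g) = c * hinge (u / c) g.
  rewrite /hinge /scaledG maxr_pMr ?(ltW c0)// mulr0 mulrBr [c * (u / c)]mulrC.
  by rewrite divfK// gt_eqF.
under eq_integral do rewrite E EFinM.
rewrite ge0_integralZl_EFin ?(ltW c0)//; last 2 first.
- by move=> g _; rewrite lee_fin hinge_ge0.
- by apply/measurable_EFinP; exact: measurable_hinge.
rewrite gaussian_hinge -EFinM mulrBr mulrA [c * (u / c)]mulrC.
by rewrite divfK// gt_eqF.
Qed.

Lemma scaledG_gt (t : R) :
  gaussian R [set g | t < scaledG c g] = (Q (t / c))%:E.
Proof.
rewrite -gaussian_gt; congr (gaussian R _); apply/seteqP.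
by split => g /=; rewrite /scaledG ltr_pdivrMr// mulrC.
Qed.

Lemma scaledG_hinge_tail (u : R) :
  (\int[gaussian R]_g (hinge u (scaledG c g))%:E)%E =
  (\int[mu]_(t in `[u, +oo[) (Q (t / c))%:E)%E.
Proof.
rewrite stop_loss_tail; last exact: measurable_scaledG.
by apply: eq_integral => t _; exact: scaledG_gt.
Qed.

Lemma scaledG_hingeN (u : R) :
  (\int[gaussian R]_g (hinge u (- scaledG c g))%:E)%E =
  (\int[gaussian R]_g (hinge u (scaledG c g))%:E)%E.
Proof.
rewrite scaledG_hinge_tail (@stop_loss_tail _ _ _ _ (fun g => - scaledG c g)); last first.
  by apply: measurableT_comp => //; exact: measurable_scaledG.
apply: eq_integral => t _.
have -> : [set w : measurableTypeR R | t < - scaledG c w] =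
    ~` [set g : measurableTypeR R | - t / c <= g].
  apply/seteqP; split => g /=; rewrite /scaledG ltrNr -ltr_pdivlMl// [c^-1 * _]mulrC.
    by rewrite ltNge => /negP.
  by move/negP; rewrite -ltNge.
have mA : measurable [set g : measurableTypeR R | - t / c <= g].
  rewrite (_ : [set g | _] = `[- t / c, +oo[%classic); first exact: measurable_itv.
  by apply/seteqP; split => w /=; rewrite in_itv/= andbT.
rewrite probability_setC//.
have -> : gaussian R [set g | - t / c <= g] = (Q (- t / c))%:E.
  rewrite gauss_tailE /gaussian/= /normal_prob; congr (integral _ _ _).
  by apply/seteqP; split => y /=; rewrite in_itv/= andbT.
by rewrite mulNr gauss_tailN -EFinB subKr.
Qed.

Lemma integrable_scaledG : (gaussian R).-integrable setT (EFin \o scaledG c).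
Proof.
apply/integrableP; split; first by apply/measurable_EFinP; exact: measurable_scaledG.
under eq_integral do rewrite abse_EFin.
rewrite integral_norm_hinge0; last exact: measurable_scaledG.
by rewrite scaledG_hingeN !scaledG_hinge -EFinD ltry.
Qed.

Lemma integral_scaledG : (\int[gaussian R]_g (scaledG c g)%:E = 0)%E.
Proof. by rewrite integral_hinge0 scaledG_hingeN scaledG_hinge subee. Qed.

End scaled_gaussian.

(** * The parameters [a], [p0], [z] and [c0] *)

Section parameters.
Variable R : realType.
Local Notation phi := (@gauss_density R).
Local Notation Q := (@gauss_tail R).
Local Notation mu := (@lebesgue_measure R).
Local Notation s2pi := (Num.sqrt (2 * pi) : R).

(** This is [e^x > 1 + x] at [x = - ln 2]. Together with [pi >= 2] it yields [pi * ln 2 > 1], on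
    which [c0_gt1] rests. *)
Lemma ln2_gt_half : 2^-1 < ln 2 :> R.
Proof.
have l0 : 0 < ln 2 :> R by rewrite ln_gt0// ltr1n.
have := @expR_gt1Dx R (- ln 2); rewrite expRN lnK ?posrE//.
by move=> /(_ ltac:(by rewrite oppr_eq0 gt_eqF)); lra.
Qed.

Lemma t0_gt0 : 0 < t0 R.
Proof. by rewrite sqrtr_gt0; have := ln2_gt_half; lra. Qed.

Lemma sqr_t0 : t0 R ^+ 2 = 2 * ln 2.
Proof. by rewrite sqr_sqrtr//; have := ln2_gt_half; lra. Qed.

Lemma expR_t0 : expR (- t0 R ^+ 2 / 2) = 2^-1.
Proof.
rewrite sqr_t0 (_ : - (2 * ln 2) / 2 = - ln 2); last by field.
by rewrite expRN lnK// posrE.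
Qed.

Lemma expR_sqr_le (x y : R) : 0 <= x -> x <= y ->
  expR (- y ^+ 2 / 2) <= expR (- x ^+ 2 / 2).
Proof. by move=> x0 xy; rewrite ler_expR; nra. Qed.

Lemma tail_bound1 (t : R) : 0 <= t -> t <= t0 R -> tail_bound t = 1.
Proof.
move=> t_ge0 tt0; rewrite /tail_bound min_l//.
by have := expR_sqr_le t_ge0 tt0; rewrite expR_t0; lra.
Qed.

Lemma tail_bound_exp (t : R) : t0 R <= t -> tail_bound t = 2 * expR (- t ^+ 2 / 2).
Proof.
move=> t0t; rewrite /tail_bound min_r//.
by have := expR_sqr_le (ltW t0_gt0) t0t; rewrite expR_t0; lra.
Qed.

Lemma tail_bound_ge0 (t : R) : 0 <= tail_bound t.
Proof. by rewrite le_min ler01 mulr_ge0 ?expR_ge0. Qed.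

Lemma measurable_gauss_exp : measurable_fun setT (fun t : R => expR (- t ^+ 2 / 2)).
Proof.
apply: measurableT_comp => //; apply: measurable_funM => //.
by apply: measurableT_comp => //; exact: measurable_funX.
Qed.

Lemma measurable_tail_bound : measurable_fun setT (@tail_bound R).
Proof.
apply: measurable_minr => //; apply: measurable_funM => //.
exact: measurable_gauss_exp.
Qed.

Lemma s2pi_ge1 : 1 <= s2pi.
Proof.
rewrite -[leLHS]sqrtr1 ler_sqrt ?mulr_ge0 ?pi_ge0//.
by have := pi_ge2 R; lra.
Qed.

Lemma gauss_exp_density (t : R) : expR (- t ^+ 2 / 2) = s2pi * phi t.
Proof.
rewrite gauss_densityE mulrA mulfV ?mul1r// gt_eqF//.
exact: lt_le_trans s2pi_ge1.
Qed.

Lemma integral_gauss_exp (x : R) :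
  (\int[mu]_(t in `[x, +oo[) (expR (- t ^+ 2 / 2))%:E = (s2pi * Q x)%:E)%E.
Proof.
under eq_integral do rewrite gauss_exp_density EFinM.
rewrite ge0_integralZl_EFin ?sqrtr_ge0//.
- by rewrite -gauss_tailE.
- by move=> t _; rewrite lee_fin gauss_density_ge0.
- by apply/measurable_EFinP; apply: measurable_funTS; exact: measurable_gauss_density.
Qed.

Lemma HfunE (x : R) :
  Hfun x = 2 * x * expR (- x ^+ 2 / 2) + 2 * (s2pi * Q x).
Proof. by rewrite /Hfun /Rintegral integral_gauss_exp. Qed.

Lemma integral_tail_bound (x : R) : t0 R <= x ->
  (\int[mu]_(t in `[x, +oo[) (tail_bound t)%:E = (2 * (s2pi * Q x))%:E)%E.
Proof.
move=> t0x; rewrite EFinM -integral_gauss_exp -ge0_integralZl_EFin//.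
- apply: eq_integral => t; rewrite inE/= in_itv/= andbT => xt.
  by rewrite -EFinM tail_bound_exp// (le_trans t0x).
- by apply/measurable_EFinP; apply: measurable_funTS; exact: measurable_gauss_exp.
Qed.

Lemma ge0_integral_split (f : R -> R) (x y : R) : x <= y ->
  measurable_fun setT f -> (forall t, 0 <= f t) ->
  (\int[mu]_(t in `[x, +oo[) (f t)%:E =
   \int[mu]_(t in `[x, y[) (f t)%:E + \int[mu]_(t in `[y, +oo[) (f t)%:E)%E.
Proof.
move=> xy mf f0.
have E : `[x, +oo[%classic = `[x, y[ `|` `[y, +oo[ :> set R.
  apply/seteqP; split => t /=; rewrite !in_itv/= ?andbT.
    by move=> xt; have [yt|ty] := leP y t; [right|left; rewrite xt].
  by case=> [/andP[]//|]; exact: le_trans.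
rewrite E ge0_integral_setU//.
- by apply/measurable_EFinP; exact: measurable_funTS.
- by move=> t _; rewrite lee_fin.
- rewrite disj_set2E; apply/eqP; rewrite -subset0 => t [/=].
  by rewrite !in_itv/= andbT => /andP[_]; rewrite ltNge => /negP.
Qed.

(** The exponential equals [1/2] at [t0], so the flat stretch of length [t0] is exactly the first
    term of [Hfun (t0 R)]. *)
Lemma integral_tail_bound0 :
  (\int[mu]_(t in `[0%R, +oo[) (tail_bound (t : R))%:E = (Hfun (t0 R))%:E)%E.
Proof.
rewrite (ge0_integral_split (ltW t0_gt0) measurable_tail_bound tail_bound_ge0).
rewrite integral_tail_bound// HfunE EFinD expR_t0; congr (_ + _)%E.
rewrite (eq_integral (cst 1%E)); last first.
  move=> t; rewrite inE/= in_itv/= => /andP[t_ge0 tt0].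
  by rewrite tail_bound1// ltW.
rewrite integral_cst//= lebesgue_measure_itv/= lte_fin t0_gt0 mul1e -EFinB.
by congr EFin; field.
Qed.

Lemma constAE : constA R = Hfun (t0 R).
Proof. by rewrite /constA /Rintegral integral_tail_bound0. Qed.

Lemma constA_ge_t0 : t0 R <= constA R.
Proof.
rewrite constAE HfunE expR_t0.
have : 0 <= s2pi * Q (t0 R) by rewrite mulr_ge0 ?sqrtr_ge0// gauss_tail_ge0.
lra.
Qed.

Lemma constB_gt0 : 0 < constB R.
Proof. by rewrite /constB; have := constA_ge_t0; have := t0_gt0; lra. Qed.

Lemma continuous_Hfun : continuous (@Hfun R).
Proof.
have -> : @Hfun R = (fun x => 2 * x * (s2pi * phi x) + 2 * (s2pi * Q x)).
  by apply/funext => x; rewrite HfunE gauss_exp_density.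
move=> x; apply: cvgD; apply: cvgM.
- by apply: cvgM; [exact: cvg_cst|exact: cvg_id].
- by apply: cvgM; [exact: cvg_cst|exact: continuous_gauss_density].
- exact: cvg_cst.
- by apply: cvgM; [exact: cvg_cst|exact: continuous_gauss_tail].
Qed.

(** A crude decay rate, from the Mills bound and [e^y >= 1 + y], giving an explicit right endpoint
    for the intermediate value theorem; 8 is not sharp. *)
Lemma Hfun_le (x : R) : 1 <= x -> x * Hfun x <= 8.
Proof.
move=> x1; rewrite HfunE.
have H : s2pi * (x * Q x) <= expR (- x ^+ 2 / 2).
  rewrite gauss_exp_density ler_wpM2l ?sqrtr_ge0// gauss_tail_mills//.
  by rewrite (lt_le_trans _ x1).
have E : expR (- x ^+ 2 / 2) * (1 + x ^+ 2 / 2) <= 1.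
  apply: (@le_trans _ _ (expR (- x ^+ 2 / 2) * expR (x ^+ 2 / 2))).
    by rewrite ler_wpM2l ?expR_ge0// expR_ge1Dx.
  by rewrite -expRD mulNr addNr expR0.
have := expR_ge0 (- x ^+ 2 / 2); move: H E.
set e := expR _; set k := s2pi; set q := Q x => H E e0; nra.
Qed.

Lemma a_param_spec : t0 R < a_param R /\ Hfun (a_param R) = constB R.
Proof.
apply: (@xgetPex _ 0 [set a : R | t0 R < a /\ Hfun a = constB R]).
(* Chosen so that [w >= 1] and [w * constB R > 8]; [Hfun_le] then puts [Hfun w] below [constB R]. *)
pose w := t0 R + 1 + 8 / constB R.
have B0 := constB_gt0; have T0 := t0_gt0.
have B8 : 0 < 8 / constB R by rewrite divr_gt0.
have Hw : Hfun w < constB R.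
  have w0 : 0 < w by rewrite /w; lra.
  have w1 : 1 <= w by rewrite /w; lra.
  rewrite -(ltr_pM2l w0); apply: le_lt_trans (Hfun_le w1) _.
  rewrite /w mulrDl divfK ?gt_eqF//.
  by rewrite ltrDr mulr_gt0// addr_gt0.
have Ht : constB R < Hfun (t0 R).
  by rewrite -constAE /constB; have := constA_ge_t0; lra.
have tw : t0 R <= w by rewrite /w; lra.
have [|||a] := @IVT R (@Hfun R) (t0 R) w (constB R) => //.
- by apply: continuous_subspaceT; exact: continuous_Hfun.
- by rewrite ge_min le_max (ltW Hw) (ltW Ht) orbT.
rewrite in_itv/= => /andP[ta _] Ha; exists a; split => //.
rewrite lt_neqAle ta andbT; apply/eqP => tE.
by move: Ht; rewrite tE Ha ltxx.
Qed.

Lemma a_gt_t0 : t0 R < a_param R. Proof. by have [] := a_param_spec. Qed.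

Lemma a_gt0 : 0 < a_param R.
Proof. exact: lt_trans t0_gt0 a_gt_t0. Qed.

Lemma p0_gt0 : 0 < p0 R. Proof. by rewrite mulr_gt0 ?expR_gt0. Qed.

Lemma p0_lt1 : p0 R < 1.
Proof.
have : expR (- a_param R ^+ 2 / 2) < expR (- t0 R ^+ 2 / 2).
  by rewrite ltr_expR; have := a_gt_t0; have := t0_gt0; nra.
by rewrite expR_t0 /p0; lra.
Qed.

Lemma constB_a : constB R = a_param R * p0 R + 2 * (s2pi * Q (a_param R)).
Proof.
have [_ <-] := a_param_spec; rewrite HfunE /p0; congr (_ + _).
by rewrite mulrCA mulrA.
Qed.

(** The line [constB R - u * p0 R] meets the tail integral at [u = a]: the equation defining [a], in
    the form in which it is used. *)
Lemma integral_tail_bound_a :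
  (\int[mu]_(t in `[a_param R, +oo[) (tail_bound t)%:E =
   (constB R - a_param R * p0 R)%:E)%E.
Proof.
rewrite integral_tail_bound ?(ltW a_gt_t0)//; congr EFin.
by rewrite constB_a addrAC subrr add0r.
Qed.

Lemma z_param_spec : Q (z_param R) = p0 R.
Proof.
apply: (@xgetPex _ 0 [set z : R | Q z = p0 R]).
have p0_gt := p0_gt0; have p0_lt := p0_lt1.
(* Both [w * p0 R] and [w * (1 - p0 R)] are at least 1 while [w * Q w] is at most 1, so
   [Q w <= p0 R <= Q (- w)]. *)
pose w := (p0 R)^-1 + (1 - p0 R)^-1.
have ip : 0 < (p0 R)^-1 by rewrite invr_gt0.
have iq : 0 < (1 - p0 R)^-1 by rewrite invr_gt0 subr_gt0.
have w0 : 0 < w by rewrite addr_gt0.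
have wQ : w * Q w <= 1.
  apply: le_trans (gauss_tail_mills w0) _; apply: le_trans (gauss_density_le0 _) _.
  by rewrite invf_le1 ?s2pi_ge1// (lt_le_trans _ s2pi_ge1).
have wp : 1 <= w * p0 R.
  by rewrite /w mulrDl mulVf ?gt_eqF// lerDl mulr_ge0 ?ltW.
have wq : 1 <= w * (1 - p0 R).
  by rewrite /w mulrDl mulVf ?gt_eqF ?subr_gt0// lerDr mulr_ge0 ?subr_ge0// ltW.
have Qp : Q w <= p0 R by rewrite -(ler_pM2l w0); exact: le_trans wp.
have Qq : Q w <= 1 - p0 R by rewrite -(ler_pM2l w0); exact: le_trans wq.
have [|||z _ Qz] := @IVT R Q (- w) w (p0 R) => //.
- by lra.
- by apply: continuous_subspaceT; exact: continuous_gauss_tail.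
- rewrite gauss_tailN ge_min le_max Qp orbT/=.
  by apply/orP; left; lra.
by exists z.
Qed.

Lemma c0_density : c0 R * phi (z_param R) = constB R.
Proof. by rewrite /c0 divfK// gt_eqF// gauss_density_gt0. Qed.

(** From [constB R >= t0 R / 2] and the peak bound on [phi], it is enough that [s2pi * t0 R / 2]
    exceed 1; its square is [pi * ln 2]. The strict inequality makes the Gaussian tail at scale [c0]
    the heavier one at infinity. *)
Lemma c0_gt1 : 1 < c0 R.
Proof.
rewrite /c0 ltr_pdivlMr ?gauss_density_gt0// mul1r.
apply: le_lt_trans (gauss_density_le0 _) _.
have s0 : 0 < s2pi by exact: lt_le_trans s2pi_ge1.
rewrite -(ltr_pM2l s0) mulfV ?gt_eqF//.
have t0B : t0 R / 2 <= constB R by rewrite /constB; have := constA_ge_t0; lra.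
apply: (@lt_le_trans _ _ (s2pi * (t0 R / 2))); last by rewrite ler_pM2l.
have T0 := t0_gt0.
rewrite -(@ltr_pXn2r _ 2)// ?nnegrE ?mulr_ge0 ?ltW ?divr_gt0//.
rewrite expr1n exprMn sqr_sqrtr ?mulr_ge0 ?pi_ge0// expr_div_n sqr_t0.
have -> : 2 * pi * (2 * ln 2 / 2 ^+ 2) = pi * ln 2 :> R by field.
by have := pi_ge2 R; have := ln2_gt_half; nra.
Qed.
End parameters.
(** * The upper bound *)

Section stop_loss_comparison.
Variable R : realType.
Local Notation phi := (@gauss_density R).
Local Notation Q := (@gauss_tail R).
Local Notation s2pi := (Num.sqrt (2 * pi) : R).

(* Both sides are values of [z |-> phi z - u * Q z], whose derivative
   [(u - z) * phi z] changes sign at [z = u]. *)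
Lemma gauss_tangent (u z : R) : phi z - u * Q z <= phi u - u * Q u.
Proof.
pose D (x : R) : R := phi x - u * Q x.
have dD (x : R) : is_derive x 1 D ((u - x) * phi x).
  have H1 := is_derive_gauss_density x; have H2 := is_derive_gauss_tail x.
  by apply: is_derive_eq; rewrite /GRing.scale/=; ring.
have cD : continuous D.
  by move=> x; apply/differentiable_continuous/derivable1_diffP; have [] := dD x.
rewrite -/(D z) -/(D u) -subr_ge0; have [zu|uz|->] := ltgtP z u; last by rewrite subrr.
- have [x|x] := @MVT _ D _ _ _ zu (fun x _ => dD x); first exact: continuous_subspaceT.
  rewrite in_itv/= => /andP[_ xu] ->.
  by rewrite !mulr_ge0 ?gauss_density_ge0 ?subr_ge0// ltW.
- have [x|x] := @MVT _ D _ _ _ uz (fun x _ => dD x); first exact: continuous_subspaceT.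
  rewrite in_itv/= => /andP[ux _] E.
  rewrite -opprB E -!mulNr opprB !mulr_ge0 ?gauss_density_ge0 ?subr_ge0// ltW//.
Qed.

(* After factoring out [expR (- t ^+ 2 / 2)], the derivative of
   [2 * expR (- t ^+ 2 / 2) - Q (t / c)] is a convex function of [t]. *)
Lemma tail_difference_deriv_unimodal (K b t1 t2 t3 : R) :
  0 < K -> 0 <= b -> 0 <= t1 -> t1 < t2 -> t2 < t3 ->
  K * expR (b * t1 ^+ 2) < 2 * t1 -> K * expR (b * t3 ^+ 2) < 2 * t3 ->
  K * expR (b * t2 ^+ 2) < 2 * t2.
Proof.
move=> K0 b0 t1_ge0 t12 t23.
(* The tangent of the exponential at [b * t2 ^+ 2] makes everything quadratic in [t]. Weighting [t1]
   and [t3] so that their mean is [t2], the quadratic terms leave only the nonnegative remainder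
   [P0]. *)
have tangent t : expR (b * t2 ^+ 2) * (1 + b * (t ^+ 2 - t2 ^+ 2)) <= expR (b * t ^+ 2).
  have -> : b * t ^+ 2 = b * t2 ^+ 2 + b * (t ^+ 2 - t2 ^+ 2) by ring.
  by rewrite expRD ler_wpM2l ?expR_ge0// expR_ge1Dx.
set M := K * expR (b * t2 ^+ 2) => H1 H3.
have {}H1 : M * (1 + b * (t1 ^+ 2 - t2 ^+ 2)) < 2 * t1.
  by apply: le_lt_trans H1; rewrite -mulrA ler_pM2l.
have {}H3 : M * (1 + b * (t3 ^+ 2 - t2 ^+ 2)) < 2 * t3.
  by apply: le_lt_trans H3; rewrite -mulrA ler_pM2l.
have M0 : 0 < M by rewrite mulr_gt0 ?expR_gt0.
have t13 : 0 < t3 - t1 by lra.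
rewrite -(ltr_pM2r t13).
have W1 : (t3 - t2) * (M * (1 + b * (t1 ^+ 2 - t2 ^+ 2))) < (t3 - t2) * (2 * t1).
  by rewrite ltr_pM2l// subr_gt0.
have W3 : (t2 - t1) * (M * (1 + b * (t3 ^+ 2 - t2 ^+ 2))) < (t2 - t1) * (2 * t3).
  by rewrite ltr_pM2l// subr_gt0.
have P0 : 0 <= M * b * ((t3 - t2) * (t2 - t1) * (t3 - t1)).
  by rewrite !mulr_ge0 ?(ltW M0)// ?subr_ge0 ltW//; lra.
have -> : M * (t3 - t1) =
  (t3 - t2) * (M * (1 + b * (t1 ^+ 2 - t2 ^+ 2))) +
  (t2 - t1) * (M * (1 + b * (t3 ^+ 2 - t2 ^+ 2))) -
  M * b * ((t3 - t2) * (t2 - t1) * (t3 - t1)) by ring.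
have -> : 2 * t2 * (t3 - t1) = (t3 - t2) * (2 * t1) + (t2 - t1) * (2 * t3) by ring.
lra.
Qed.

(** If the difference [E] of the two tails were positive at [v], then from [E 0 > 0], [E u <= 0],
    [E v > 0] and [E w < E v] for some far [w], the mean value theorem would give a negative
    derivative, then a positive one, then a negative one, against
    [tail_difference_deriv_unimodal]. *)
Lemma tail_single_crossing (c u v : R) : 1 < c -> 0 <= u -> u <= v ->
  2 * expR (- u ^+ 2 / 2) <= Q (u / c) -> 2 * expR (- v ^+ 2 / 2) <= Q (v / c).
Proof.
move=> c1 u0 uv Eu; rewrite leNgt; apply/negP => Ev.
have c0 : 0 < c by lra.
have cn0 : c != 0 by rewrite gt_eqF.
pose E (t : R) : R := 2 * expR (- t ^+ 2 / 2) - Q (t / c).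
(* These satisfy [phi (t / c) / c = expR (- t ^+ 2 / 2) * (K * expR (b * t ^+ 2))]; [c > 1] is what
   makes [b] nonnegative. *)
pose K := (c * s2pi)^-1; pose b := (1 - c^-1 ^+ 2) / 2.
have K0 : 0 < K by rewrite invr_gt0 mulr_gt0// (lt_le_trans _ (s2pi_ge1 R)).
have b0 : 0 <= b.
  by rewrite divr_ge0// subr_ge0 expr_le1// ?invr_ge0 ?invf_le1// ltW.
have dE (t : R) : is_derive t 1 E (expR (- t ^+ 2 / 2) * (K * expR (b * t ^+ 2) - 2 * t)).
  have H1 := is_derive_gauss_exp t.
  have H2 : is_derive t 1 (fun x => Q (x / c)) (- phi (t / c) * c^-1).
    apply: (@is_derive1_comp _ Q (fun x => x / c)).
      exact: is_derive_gauss_tail.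
    by apply: is_derive_eq; rewrite /GRing.scale/= mulr0 add0r mulr1.
  apply: is_derive_eq; rewrite /GRing.scale/= gauss_densityE.
  rewrite mulrBr [_ * (K * _)]mulrCA -expRD.
  have -> : - t ^+ 2 / 2 + b * t ^+ 2 = - (t / c) ^+ 2 / 2 by rewrite /b; field.
  by rewrite /K invfM; ring.
have cE : continuous E.
  by move=> x; apply/differentiable_continuous/derivable1_diffP; have [] := dE x.
have mvt x y : x < y -> exists t, [/\ x < t, t < y &
    E y - E x = expR (- t ^+ 2 / 2) * (K * expR (b * t ^+ 2) - 2 * t) * (y - x)].
  move=> xy; have [|t] := @MVT _ E _ _ _ xy (fun x _ => dE x).
    exact: continuous_subspaceT.
  by rewrite in_itv/= => /andP[xt ty] ->; exists t.
have Ev0 : 0 < E v by rewrite subr_gt0.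
have Eu0 : E u <= 0 by rewrite subr_le0.
have E00 : 0 < E 0.
  rewrite /E expr0n oppr0 mul0r expR0 mulr1 mul0r.
  by have := gauss_tail_le1 (0 : R); lra.
have up : 0 < u.
  by rewrite lt_neqAle u0 andbT; apply/eqP => u0E; move: Eu0; rewrite -u0E; lra.
have uv' : u < v.
  by rewrite lt_neqAle uv andbT; apply/eqP => uvE; move: Eu0; rewrite uvE; lra.
(* Far enough that [E w <= 2 * expR (- w ^+ 2 / 2) < 4 / w < E v]. *)
pose w := v + 1 + 4 / E v.
have iE : 0 < 4 / E v by rewrite divr_gt0.
have vw : v < w by rewrite /w; lra.
have Ew : E w < E v.
  apply: (@le_lt_trans _ _ (2 * expR (- w ^+ 2 / 2))).
    by rewrite /E gerBl gauss_tail_ge0.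
  have w1 : 1 <= w by rewrite /w; lra.
  have wE : 4 < w * E v.
    rewrite /w mulrDl divfK ?gt_eqF// ltrDr mulr_gt0//; lra.
  have e1 : expR (- w ^+ 2 / 2) * (1 + w ^+ 2 / 2) <= 1.
    apply: (@le_trans _ _ (expR (- w ^+ 2 / 2) * expR (w ^+ 2 / 2))).
      by rewrite ler_wpM2l ?expR_ge0// expR_ge1Dx.
    by rewrite -expRD mulNr addNr expR0.
  have := expR_gt0 (- w ^+ 2 / 2); move: e1; set e := expR _ => e1 e0.
  nra.
have sgn t d : 0 < d ->
    (expR (- t ^+ 2 / 2) * (K * expR (b * t ^+ 2) - 2 * t) * d < 0) =
    (K * expR (b * t ^+ 2) < 2 * t).
  by move=> d0; rewrite pmulr_llt0// pmulr_rlt0 ?expR_gt0// subr_lt0.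
have [t1 [t1_gt0 t1u]] := mvt _ _ up.
have [t2 [ut2 t2v E2]] := mvt _ _ uv'.
have [t3 [vt3 _]] := mvt _ _ vw.
move=> E3 E1.
have S1 : K * expR (b * t1 ^+ 2) < 2 * t1.
  by rewrite -(sgn t1 (u - 0)) ?subr_gt0// -E1 subr_lt0 (le_lt_trans Eu0).
have S3 : K * expR (b * t3 ^+ 2) < 2 * t3.
  by rewrite -(sgn t3 (w - v)) ?subr_gt0// -E3 subr_lt0.
have := tail_difference_deriv_unimodal K0 b0 (ltW t1_gt0) (lt_trans t1u ut2)
  (lt_trans t2v vt3) S1 S3.
by rewrite -(sgn t2 (v - u)) ?subr_gt0// -E2 subr_lt0 ltNge (le_trans Eu0 (ltW Ev0)).
Qed.

End stop_loss_comparison.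

(** * Stop-loss bounds for admissible variables *)

Section stop_loss_bound.
Variable R : realType.
Local Notation Q := (@gauss_tail R).
Local Notation mu := (@lebesgue_measure R).
Local Notation a := (a_param R).

Lemma c0_gt0 : 0 < c0 R. Proof. exact: lt_trans (c0_gt1 R). Qed.

Lemma c0_hinge_ge_tangent (u : R) :
  ((constB R - u * p0 R)%:E <=
    \int[gaussian R]_g (hinge u (scaledG (c0 R) g))%:E)%E.
Proof.
have c_gt0 := c0_gt0.
rewrite scaledG_hinge// lee_fin -c0_density -z_param_spec.
have := gauss_tangent (u / c0 R) (z_param R).
have E y : c0 R * (u / c0 R * y) = u * y by field; rewrite gt_eqF.
by move/(ler_wpM2l (ltW c_gt0)); rewrite !mulrBr !E.
Qed.

Lemma measurable_scaled_gauss_tail (c : R) : measurable_fun setT (fun t : R => Q (t / c)).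
Proof.
apply: measurableT_comp; last exact: measurable_funM.
by apply: continuous_measurable_fun; exact: continuous_gauss_tail.
Qed.

Lemma c0_hinge_ge_tail (u : R) : a <= u ->
  (\int[mu]_(t in `[u, +oo[) (tail_bound t)%:E <=
    \int[gaussian R]_g (hinge u (scaledG (c0 R) g))%:E)%E.
Proof.
move=> au; have c_gt0 := c0_gt0.
have t0a t : a <= t -> t0 R <= t by exact: le_trans (ltW (a_gt_t0 R)).
have mQ := measurable_scaled_gauss_tail (c0 R).
have mtb : measurable_fun setT (@tail_bound R) by exact: measurable_tail_bound.
rewrite scaledG_hinge_tail//.
(* If the tails have crossed by [u], the integrands compare pointwise beyond [u]. Otherwise
   [tail_bound] exceeds the Gaussian tail on all of [[a, u]], and removing [[a, u[] from the
   comparison at [a] takes more from the smaller side. *)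
have [[t [at_ tu Et]]|noE] := pselect (exists t, [/\ a <= t, t <= u &
    2 * expR (- t ^+ 2 / 2) <= Q (t / c0 R)]).
  apply: ge0_le_integral => //.
  - by move=> s _; rewrite lee_fin tail_bound_ge0.
  - by apply/measurable_EFinP; exact: measurable_funTS.
  - by apply/measurable_EFinP; exact: measurable_funTS.
  - move=> s /=; rewrite in_itv/= andbT => us.
    have ts := le_trans tu us.
    rewrite lee_fin tail_bound_exp; last by apply: t0a; exact: le_trans ts.
    apply: tail_single_crossing ts Et; first exact: c0_gt1.
    exact: le_trans (ltW (a_gt0 R)) at_.
have Ha : (\int[mu]_(t in `[a, +oo[) (tail_bound t)%:E <=
    \int[mu]_(t in `[a, +oo[) (Q (t / c0 R))%:E)%E.
  rewrite integral_tail_bound_a -scaledG_hinge_tail//.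
  exact: c0_hinge_ge_tangent.
have fin_au : (\int[mu]_(t in `[a, u[) (tail_bound t)%:E)%E \is a fin_num.
  have := integral_tail_bound_a R.
  rewrite (ge0_integral_split au mtb (@tail_bound_ge0 R)).
  move=> /(congr1 (fun x => x \is a fin_num)).
  by rewrite fin_numD => /andP[].
rewrite -(leeD2lE _ _ fin_au) -(ge0_integral_split au mtb (@tail_bound_ge0 R)).
apply: le_trans Ha _.
rewrite (ge0_integral_split au mQ) => [|t]; last exact: gauss_tail_ge0.
rewrite leeD2r//; apply: ge0_le_integral => //.
- by move=> t _; rewrite lee_fin gauss_tail_ge0.
- by apply/measurable_EFinP; exact: measurable_funTS.
- by apply/measurable_EFinP; exact: measurable_funTS.
- move=> t /=; rewrite in_itv/= => /andP[at_ tu].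
  rewrite lee_fin tail_bound_exp ?t0a// leNgt; apply/negP => tQ.
  by apply: noE; exists t; split => //; exact: ltW.
Qed.

Section upper_bound.
Context d (T : measurableType d) (P : probability T R) (X : T -> R).
Hypothesis iX : P.-integrable setT (EFin \o X).
Hypothesis EX : (\int[P]_w (X w)%:E = 0)%E.
Hypothesis tX : forall t : R, 0 <= t ->
  (P [set w | (t < `|X w|)%R] <= (tail_bound t)%:E)%E.

Let mX : measurable_fun setT X.
Proof. by apply/measurable_EFinP; exact: measurable_int iX. Qed.

Let iNX : P.-integrable setT (EFin \o (fun w => - X w)).
Proof. by have := integrableN iX. Qed.

Let mgt (Y : T -> R) (t : R) : measurable_fun setT Y -> measurable [set w | t < Y w].
Proof.
move=> mY; rewrite (_ : [set w | _] = setT `&` Y @^-1` `]t, +oo[); first exact: mY.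
by apply/seteqP; split => w /=; rewrite in_itv/= andbT// => -[].
Qed.

(** Stated for any [Y] below [|X|] so that it serves for [X] and for [|X|] itself, the latter giving
    the bound by [constA] at [u = 0]. *)
Lemma hinge_le_tail (Y : T -> R) (u : R) : measurable_fun setT Y ->
  (forall w, Y w <= `|X w|) -> 0 <= u ->
  (\int[P]_w (hinge u (Y w))%:E <= \int[mu]_(t in `[u, +oo[) (tail_bound t)%:E)%E.
Proof.
move=> mY YX u0; rewrite stop_loss_tail//.
have -> : (\int[mu]_(t in `[u, +oo[) P [set w | (t < Y w)%R] =
    \int[mu]_(t in `[u, +oo[) (fine (P [set w | (t < Y w)%R]))%:E)%E.
  by apply: eq_integral => t _; rewrite fineK// fin_num_measure//; exact: mgt.
apply: ge0_le_integral => //.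
- by move=> t _; rewrite lee_fin fine_ge0.
- apply/measurable_EFinP/measurable_funTS.
  apply: nonincreasing_measurable => // s t st.
  rewrite fine_le ?fin_num_measure//; try exact: mgt.
  apply: le_measure; rewrite ?inE; try exact: mgt.
  by move=> w /=; exact: le_lt_trans.
- by apply/measurable_EFinP; apply: measurable_funTS; exact: measurable_tail_bound.
- move=> t /=; rewrite in_itv/= andbT => ut.
  rewrite fineK ?fin_num_measure//; last exact: mgt.
  apply: le_trans (tX (le_trans u0 ut)).
  apply: le_measure; rewrite ?inE; try exact: mgt.
    by apply: mgt; exact: measurableT_comp.
  by move=> w /= tY; exact: lt_le_trans (YX w).
Qed.

Lemma hinge0_le_constB : (\int[P]_w (hinge 0 (X w))%:E <= (constB R)%:E)%E.
Proof.
have : (\int[P]_w (hinge 0 `|X w|)%:E <= (constA R)%:E)%E.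
  rewrite constAE -integral_tail_bound0; apply: hinge_le_tail => //.
  exact: measurableT_comp.
under eq_integral do rewrite hingeE// subr0.
rewrite integral_norm_hinge0//.
have fp := integrable_fin_num measurableT (integrable_hinge 0 iX).
have fn := integrable_fin_num measurableT (integrable_hinge (X := fun w => - X w) 0 iNX).
move: EX; rewrite integral_hinge0 -(fineK fp) -(fineK fn) -EFinB -EFinD !lee_fin.
by move=> -[] H1 H2; rewrite /constB; lra.
Qed.

Lemma hinge_le_c0 (u : R) : 0 <= u ->
  (\int[P]_w (hinge u (X w))%:E <=
    \int[gaussian R]_g (hinge u (scaledG (c0 R) g))%:E)%E.
Proof.
move=> u0; have a0 := a_gt0 R.
have XX w : X w <= `|X w| by exact: ler_norm.
have [au|ua] := leP a u.
  apply: le_trans (c0_hinge_ge_tail au); exact: hinge_le_tail.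
apply: le_trans (c0_hinge_ge_tangent u).
have mh v := measurable_EFin_hinge v mX.
have h0 v : forall w, setT w -> (0 <= (hinge v (X w))%:E)%E.
  by move=> w _; rewrite lee_fin hinge_ge0.
have la : (0 <= 1 - u / a) by rewrite subr_ge0 ler_pdivrMr// mul1r ltW.
have lu : (0 <= u / a) by rewrite divr_ge0// ltW.
(* Convexity of the hinge in its threshold, applied pointwise at
   [u = (1 - u / a) * 0 + (u / a) * a]. *)
apply: (@le_trans _ _ (\int[P]_w ((1 - u / a)%:E * (hinge 0 (X w))%:E +
    (u / a)%:E * (hinge a (X w))%:E))%E).
  apply: ge0_le_integral => //; first exact: h0.
    by apply: emeasurable_funD; exact: measurable_funeM.
  move=> w _; rewrite -!EFinM -EFinD lee_fin.
  have E : u = u / a * a by rewrite divfK// gt_eqF.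
  move: la lu (hinge_ge0 0 (X w)) (hinge_ge0 a (X w)).
  move: (hinge_ge 0 (X w)) (hinge_ge a (X w)).
  rewrite {5}/hinge ge_max; set l := u / a in E *; set p := hinge 0 _; set q := hinge a _.
  by move=> *; apply/andP; split; nra.
rewrite ge0_integralD//; last 4 first.
- by move=> w _; rewrite mule_ge0// ?lee_fin// hinge_ge0.
- exact: measurable_funeM.
- by move=> w _; rewrite mule_ge0// ?lee_fin// hinge_ge0.
- exact: measurable_funeM.
rewrite !ge0_integralZl_EFin//; try exact: h0.
have -> : (constB R - u * p0 R)%:E =
    ((1 - u / a)%:E * (constB R)%:E + (u / a)%:E * (constB R - a * p0 R)%:E)%E.
  by rewrite -!EFinM -EFinD; congr EFin; field; rewrite gt_eqF.
apply: leeD; apply: lee_wpmul2l; rewrite ?lee_fin//.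
  exact: hinge0_le_constB.
rewrite -integral_tail_bound_a; apply: hinge_le_tail => //; exact: ltW.
Qed.

End upper_bound.

End stop_loss_bound.
(** * The extremal variable *)

Section extremal_variable.
Variable R : realType.
Local Notation mu := (@lebesgue_measure R).

Definition unit_uniform : probability (measurableTypeR R) R := uniform_prob (@ltr01 R).
Local Notation U := unit_uniform.

(* Inverse transform sampling of a variable with tail [tail_bound]. *)
Definition extremal_norm (u : R) : R :=
  if 0 < u then Num.sqrt (2 * (ln 2 - ln u)) else 0.

(** [extremal_norm] is nonincreasing on [u > 0] and equals [a] at [p0 R = 2 * expR (- a ^+ 2 / 2)],
    so for [u > 0] the test [u < p0 R] selects exactly the values above [a]. *)
Definition extremal (u : measurableTypeR R) : R :=
  if u < p0 R then extremal_norm u else - extremal_norm u.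

Lemma measurable_extremal_norm : measurable_fun setT extremal_norm.
Proof.
apply: measurable_fun_ifT => //.
  by apply: measurable_fun_ltr.
apply: measurableT_comp.
  by apply: continuous_measurable_fun; exact: sqrt_continuous.
by apply: measurable_funM => //; exact: measurable_funB.
Qed.

Lemma measurable_extremal : measurable_fun setT extremal.
Proof.
apply: measurable_fun_ifT.
- by apply: measurable_fun_ltr.
- exact: measurable_extremal_norm.
- by apply: measurableT_comp => //; exact: measurable_extremal_norm.
Qed.

HB.instance Definition _ :=
  @isMeasurableFun.Build _ _ _ _ extremal measurable_extremal.

Lemma extremal_norm_ge0 (u : R) : 0 <= extremal_norm u.
Proof. by rewrite /extremal_norm; case: ifP => // _; exact: sqrtr_ge0. Qed.

Lemma extremal_normE (u : R) : `|extremal u| = extremal_norm u.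
Proof.
by rewrite /extremal; case: ifP => _; rewrite ?normrN ger0_norm// extremal_norm_ge0.
Qed.

Lemma extremal_norm_gt (t u : R) : 0 <= t ->
  (t < extremal_norm u) = (0 < u) && (u < 2 * expR (- t ^+ 2 / 2)).
Proof.
move=> t_ge0; rewrite /extremal_norm; case: ifP => [u0|_] /=; last by rewrite ltNge t_ge0.
have -> : (u < 2 * expR (- t ^+ 2 / 2)) = (t ^+ 2 < 2 * (ln 2 - ln u)).
  rewrite -{1}(@lnK _ 2) ?posrE// -{1}(@lnK _ u) ?posrE// -expRD ltr_expR.
  by apply/idP/idP; lra.
(* [y <= 0] means [u >= 2]: the square root is then 0 by convention, and both sides are false. *)
set y := 2 * _; have [y0|y0] := leP y 0.
  by rewrite (ler0_sqrtr y0) !ltNge t_ge0 (le_trans y0)// sqr_ge0.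
by rewrite -{1}(ger0_norm t_ge0) -sqrtr_sqr ltr_sqrt.
Qed.

Lemma unit_uniform_lt (s : R) : 0 <= s ->
  U [set u | 0 < u < s] = (Num.min 1 s)%:E.
Proof.
move=> s0.
have E : [set u : R | 0 < u < s] = `]0, s[%classic.
  by apply/seteqP; split => u /=; rewrite in_itv.
rewrite E -[X in U X]setIT -integral_indic//.
rewrite (@integral_uniform _ _ _ (@ltr01 R) (fun x => (\1_`]0, s[ x)%:E))//; last first.
  by apply/measurable_EFinP; apply: measurable_indic; exact: measurable_itv.
rewrite subr0 invr1 mul1e integral_indic//=.
have [s1|s1] := leP 1 s.
  have [s1'|] := leP s 1.
    have -> : `]0, s[ `&` `[0, 1] = `]0, 1[%classic :> set R.
      have -> : s = 1 by apply: le_anti; rewrite s1 s1'.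
      apply/seteqP; split => u /=; rewrite !in_itv/=; first by case.
      by move=> /andP[u0 u1]; rewrite u0 u1 !ltW.
    by rewrite lebesgue_measure_itv/= lte_fin ltr01 sube0.
  move=> s1''; have -> : `]0, s[ `&` `[0, 1] = `]0, 1]%classic :> set R.
    apply/seteqP; split => u /=; rewrite !in_itv/=.
      by move=> [/andP[-> _] /andP[_ ->]].
    by move=> /andP[u0 u1]; rewrite u0 u1 (le_lt_trans u1)// ltW.
  by rewrite lebesgue_measure_itv/= lte_fin ltr01 sube0.
have -> : `]0, s[ `&` `[0, 1] = `]0, s[%classic :> set R.
  apply/seteqP; split => u /=; rewrite !in_itv/=; first by case.
  by move=> /andP[u0 us]; rewrite u0 us !ltW// (lt_trans us).
rewrite lebesgue_measure_itv/= lte_fin.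
by move: s0; rewrite le_eqVlt => /orP[/eqP<-|->]; rewrite ?ltxx// sube0.
Qed.

Lemma extremal_norm_tail (t : R) : 0 <= t ->
  U [set u | t < `|extremal u|] = (tail_bound t)%:E.
Proof.
move=> t_ge0; rewrite /tail_bound -unit_uniform_lt ?mulr_ge0 ?expR_ge0//.
congr (U _); apply/funext => u /=.
by rewrite extremal_normE extremal_norm_gt.
Qed.

Lemma extremal_tail (t : R) : 0 <= t ->
  U [set u | t < extremal u] = (Num.min (p0 R) (tail_bound t))%:E.
Proof.
move=> t_ge0; pose s := Num.min (p0 R) (2 * expR (- t ^+ 2 / 2)).
have -> : Num.min (p0 R) (tail_bound t) = Num.min 1 s.
  by rewrite /tail_bound /s minCA.
have p0_gt := p0_gt0 R.
rewrite -unit_uniform_lt; last by rewrite le_min ltW ?mulr_ge0 ?expR_ge0.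
congr (U _); apply/funext => u /=; apply/propext.
rewrite /extremal lt_min; case: ifPn => up.
  by rewrite extremal_norm_gt.
split => [tu|/and3P[]//].
by have := extremal_norm_ge0 u; lra.
Qed.

Lemma integral_norm_extremal : (\int[U]_u `|extremal u|%:E = (constA R)%:E)%E.
Proof.
have -> : (\int[U]_u `|extremal u|%:E = \int[U]_u (hinge 0 `|extremal u|)%:E)%E.
  by apply: eq_integral => u _; rewrite hingeE// subr0.
rewrite (@stop_loss_tail _ _ _ U (fun u => `|extremal u|)); last first.
  by apply: measurableT_comp => //; exact: measurable_extremal.
rewrite constAE -integral_tail_bound0; apply: eq_integral => t.
rewrite inE/= in_itv/= andbT => t_ge0; exact: extremal_norm_tail.
Qed.

(** The tail of the positive part is [p0 R] up to [a] and [tail_bound] beyond; the pieces [a * p0]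
    and [constB - a * p0] add up to half of [constA], and hence the mean is zero. *)
Lemma integral_hinge_extremal : (\int[U]_u (hinge 0 (extremal u))%:E = (constB R)%:E)%E.
Proof.
have a0 := ltW (a_gt0 R); have p0_ge := ltW (p0_gt0 R).
rewrite stop_loss_tail; last exact: measurable_extremal.
have -> : (\int[mu]_(t in `[0%R, +oo[) U [set w | (t < extremal w)%R] =
    \int[mu]_(t in `[0%R, +oo[) (Num.min (p0 R) (tail_bound t))%:E)%E.
  apply: eq_integral => t; rewrite inE/= in_itv/= andbT => t_ge0.
  exact: extremal_tail.
rewrite (ge0_integral_split a0); last 2 first.
- apply: measurable_minr => //; exact: measurable_tail_bound.
- by move=> t; rewrite le_min p0_ge tail_bound_ge0.
have -> : (\int[mu]_(t in `[0%R, a_param R[) (Num.min (p0 R) (tail_bound t))%:E =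
    \int[mu]_(t in `[0%R, a_param R[) (cst (p0 R)%:E t))%E.
  apply: eq_integral => t; rewrite inE/= in_itv/= => /andP[t_ge0 ta].
  rewrite min_l// le_min (ltW (p0_lt1 R)) /p0 ler_pM2l//.
  by apply: expR_sqr_le => //; exact: ltW.
have -> : (\int[mu]_(t in `[a_param R, +oo[) (Num.min (p0 R) (tail_bound t))%:E =
    \int[mu]_(t in `[a_param R, +oo[) (tail_bound t)%:E)%E.
  apply: eq_integral => t; rewrite inE/= in_itv/= andbT => at_.
  rewrite min_r// tail_bound_exp; last exact: le_trans (ltW (a_gt_t0 R)) at_.
  by rewrite /p0 ler_pM2l//; apply: expR_sqr_le.
rewrite integral_tail_bound_a integral_cst//= lebesgue_measure_itv/= lte_fin a_gt0.
by rewrite oppr0 adde0 -EFinM -EFinD; congr EFin; ring.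
Qed.

Lemma integrable_extremal : U.-integrable setT (EFin \o extremal).
Proof.
apply/integrableP; split; first by apply/measurable_EFinP; exact: measurable_extremal.
under eq_integral do rewrite abse_EFin.
by rewrite integral_norm_extremal ltry.
Qed.

Lemma integral_extremal : (\int[U]_u (extremal u)%:E = 0)%E.
Proof.
have iN : U.-integrable setT (EFin \o (fun u => - extremal u)).
  by have := integrableN integrable_extremal.
have fn := integrable_fin_num measurableT
  (integrable_hinge (X := fun u => - extremal u) 0 iN).
have := integral_norm_extremal.
rewrite integral_norm_hinge0; last exact: measurable_extremal.
rewrite [X in _ -> X = _]integral_hinge0 integral_hinge_extremal.
rewrite -(fineK fn) -EFinD -EFinB => -[].
by move=> H; congr EFin; move: H; rewrite /constB; lra.
Qed.

Lemma extremal_centered_tail_bounded :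
  centered_tail_bounded (extremal : {RV U >-> R}).
Proof.
split; first exact: integrable_extremal.
- by rewrite expectation.unlock integral_extremal.
- by move=> t t_ge0; rewrite extremal_norm_tail.
Qed.

(** The hinge at [v] is at least [extremal u - v] on the event [A] of mass [p0 R] that carries the
    positive part, and at least 0 elsewhere. The bound holds for [v] of either sign, which covers
    [c * z] without locating [z]. *)
Lemma extremal_hinge_ge (v : R) :
  ((constB R - v * p0 R)%:E <= \int[U]_u (hinge v (extremal u))%:E)%E.
Proof.
pose A := [set u : measurableTypeR R | 0 < u < p0 R].
have mA : measurable A.
  rewrite (_ : A = `]0, p0 R[%classic); first exact: measurable_itv.
  by apply/seteqP; split => u /=; rewrite in_itv.
have UA : U A = (p0 R)%:E.
  rewrite unit_uniform_lt ?(ltW (p0_gt0 R))// min_r//.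
  exact: ltW (p0_lt1 R).
have iA : U.-integrable setT (fun u => (v * \1_A u)%:E).
  under eq_fun do rewrite EFinM; apply: integrableZl => //.
  exact: integrable_indic.
have ih w := integrable_hinge w integrable_extremal.
have <- : (\int[U]_u ((hinge 0 (extremal u))%:E - (v * \1_A u)%:E) =
    (constB R - v * p0 R)%:E)%E.
  rewrite (integralB_EFin (f1 := fun u => hinge 0 (extremal u))
    (f2 := fun u => v * \1_A u) measurableT (ih 0) iA).
  rewrite integral_hinge_extremal.
  under [X in (_ - X)%E]eq_integral do rewrite EFinM.
  rewrite integralZl//; last exact: integrable_indic.
  suff -> : (\int[U]_x (\1_A x)%:E = (p0 R)%:E)%E by [].
  by rewrite integral_indic// setIT; exact: UA.
apply: le_integral => //; first exact: integrableB.
move=> u _; rewrite -EFinB lee_fin indicE.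
have [|nA] := boolP (u \in A).
  rewrite inE /A/= => /andP[u0 up]; rewrite /extremal up mulr1.
  by rewrite [hinge 0 _]hingeE ?extremal_norm_ge0// subr0 hinge_ge.
rewrite mulr0 subr0 hinge_eq0 ?hinge_ge0//.
rewrite notin_setE /A/= in nA; rewrite /extremal; case: ifPn => up.
  rewrite /extremal_norm; case: ifP => // u0.
  by exfalso; apply: nA; rewrite u0.
by rewrite oppr_le0 extremal_norm_ge0.
Qed.

End extremal_variable.

(** * Domination by [c0 G], sharpness, and the value of [c_star] *)

Lemma convex_hinge (R : realType) (v : R) : convex_on_line (hinge v).
Proof.
apply: chord_convex_convex_on_line => x y z xy yz.
have hx := hinge_ge v x; have hz := hinge_ge v z.
have hx0 := hinge_ge0 v x; have hz0 := hinge_ge0 v z.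
have [yv|vy] := leP y v.
  by rewrite (hinge_eq0 yv) mul0r addr_ge0// mulr_ge0// subr_ge0.
by rewrite (hingeE (ltW vy)); nra.
Qed.

(** The hypotheses on [X] are invariant under [X -> - X] and the Gaussian is symmetric, so the
    one-sided bound [hinge_le_c0] serves for both signs. *)
Lemma centered_tail_bounded_cx (R : realType) (d : measure_display)
    (T : measurableType d) (P : probability T R) (X : {RV P >-> R}) (f : R -> R) :
  centered_tail_bounded X -> convex_on_line f ->
  'E_(gaussian R)[f \o scaledG (c0 R)]%E \is a fin_num ->
  ('E_P[f \o X] <= 'E_(gaussian R)[f \o scaledG (c0 R)])%E.
Proof.
move=> [iX EX tX] cf; rewrite !expectation.unlock => finf.
rewrite expectation.unlock in EX.
have c_gt0 := c0_gt0 R.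
have iNX : P.-integrable setT (EFin \o (fun w => - X w)).
  by have := integrableN iX.
have ENX : (\int[P]_w (- X w)%:E = 0)%E.
  by under eq_integral do rewrite -mulN1r EFinM; rewrite integralZl// EX mule0.
have tNX t : 0 <= t -> (P [set w | (t < `|- X w|)%R] <= (tail_bound t)%:E)%E.
  by under eq_set do rewrite normrN; exact: tX.
apply: (hinge_domination_convex (f := f) (X := X) (Y := scaledG (c0 R))) => //.
- exact: convex_on_line_chord_convex.
- exact: integrable_scaledG.
- by rewrite EX integral_scaledG.
- by move=> u; exact: hinge_le_c0.
- move=> u u0; rewrite scaledG_hingeN//.
  exact: (hinge_le_c0 (X := fun w => - X w)).
Qed.

(** At threshold [c * z] the Gaussian side is [c * phi z - c * z * p0] and the extremal side is at
    least [c0 * phi z - c * z * p0]: the slopes agree and the gap is at least [(c0 - c) * phi z]. *)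
Lemma scaledG_extremal_lt (R : realType) (c : R) : 0 < c -> c < c0 R ->
  ('E_(gaussian R)[hinge (c * z_param R) \o scaledG c] <
   'E_(unit_uniform R)[hinge (c * z_param R) \o @extremal R])%E.
Proof.
move=> c_gt0 cc0; rewrite !expectation.unlock.
apply: lt_le_trans (extremal_hinge_ge (c * z_param R)).
rewrite scaledG_hinge//.
rewrite (_ : c * z_param R / c = z_param R); last by field; rewrite gt_eqF.
rewrite z_param_spec lte_fin.
by rewrite -c0_density ltrD2r ltr_pM2r// gauss_density_gt0.
Qed.

Lemma c_star_c0 (R : realType) : c_star R = c0 R.
Proof.
rewrite /c_star; set S := [set c | _].
have Sc0 : S (c0 R).
  split; first exact: c0_gt0.
  by move=> d T P X XP f cf _ ?; exact: centered_tail_bounded_cx.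
have lbS : lbound S (c0 R).
  move=> c [c_gt0 Sc]; rewrite leNgt; apply/negP => cc0.
  have := scaledG_extremal_lt c_gt0 cc0; rewrite ltNge => /negP; apply.
  apply: Sc (extremal_centered_tail_bounded R) _ (convex_hinge _) _ _.
  - rewrite expectation.unlock; apply: integrable_fin_num => //.
    by apply: integrable_hinge; exact: integrable_extremal.
  - rewrite expectation.unlock; apply: integrable_fin_num => //.
    by apply: integrable_hinge; exact: integrable_scaledG.
apply/eqP; rewrite eq_le; apply/andP; split.
- by apply: ge_inf => //; exists (c0 R).
- by apply: lb_le_inf => //; exists (c0 R).
Qed.

Theorem theorem1 (R : realType) :
  [/\ c_star R = c0 R,
      (forall (d : measure_display) (T : measurableType d)
         (P : probability T R) (X : {RV P >-> R}) (f : R -> R),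
         centered_tail_bounded X -> convex_on_line f ->
         'E_(gaussian R)[f \o scaledG (c0 R)]%E \is a fin_num ->
         ('E_P[f \o X] <= 'E_(gaussian R)[f \o scaledG (c0 R)])%E),
      (forall c : R, 0 < c -> c < c0 R ->
         exists (d : measure_display) (T : measurableType d)
           (P : probability T R) (X : {RV P >-> R}) (f : R -> R),
           [/\ centered_tail_bounded X,
               convex_on_line f,
               ('E_(gaussian R)[f \o scaledG c] < 'E_P[f \o X])%E
             & f = (fun x => Num.max (x - c * z_param R) 0)])
    & C48 R = c0 R ^+ 2].

Proof.
split.
- exact: c_star_c0.
- by move=> d T P X f; exact: centered_tail_bounded_cx.
- move=> c c_gt0 cc0.
  exists _, (measurableTypeR R), (unit_uniform R), (@extremal R), (hinge (c * z_param R)).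
  split => //.
  + exact: extremal_centered_tail_bounded.
  + exact: convex_hinge.
  + exact: scaledG_extremal_lt.
- by rewrite /C48 c_star_c0.
Qed.
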